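(* Let $U\in\mathbf D(l^2(A))$. There exists a unique couple $(\varphi,V)$, where $\varphi\in L^2(E_A)$ and $V\in L^2(A\times E_A)$, such that $\mathbf E[\varphi]=0$, $\delta V=0$ and $$U_a=D_a\varphi+V_a\qquad\text{for any }a\in A.$$
   Context: $A$ is an at most countable set, $(E_a,\mathcal E_a,\mathbf P_a)_{a\in A}$ are Polish spaces with probability measures, $E_A=\prod_{a\in A}E_a$ carries the product $\sigma$-field and the product measure $\mathbf P=\otimes_{a\in A}\mathbf P_a$, with expectation $\mathbf E$; $X_a$ are the coordinate random variables. $L^2(E_A)=L^2(E_A,\mathbf P)$, and $L^2(A\times E_A)$ is the Hilbert space of families $U=(U_a)_{a\in A}$ with $\|U\|^2=\sum_{a\in A}\mathbf E[U_a^2]<\infty$. A random variable is cylindrical if it belongs to $L^2(E_A)$ and depends only on $X_B=(X_a,a\in B)$ for some finite $B\subset A$. The gradient $DF=(D_aF)_{a\in A}$ is given by $D_aF(X_A)=F(X_A)-\int_{E_a}F(X_{A\setminus\{a\}},x_a)\,d\mathbf P_a(x_a)$ (this formula makes sense for each $a$ and each $F\in L^2(E_A)$). $\mathbf D$ is the closure of the cylindrical random variables for the norm $(\|F\|^2_{L^2(E_A)}+\|DF\|^2_{L^2(A\times E_A)})^{1/2}$. $\mathbf D(l^2(A))$ is the closure of the set of simple processes ($U=(U_a)_{a\in A}$ with each $U_a$ cylindrical and $U_a=0$ outside a finite subset of $A$) for the norm $\|U\|^2_{\mathbf D(l^2(A))}=\mathbf E[\sum_{a}|U_a|^2]+\mathbf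 E[\sum_{a}\sum_{b}|D_aU_b|^2]$. The divergence $\delta$ is the adjoint of $D$: $\operatorname{Dom}\delta$ is the set of $U\in L^2(A\times E_A)$ for which there is $c>0$ with $|\sum_a\mathbf E[D_aF\,U_a]|\le c\|F\|_{L^2(E_A)}$ for all $F\in\mathbf D$, and for such $U$, $\delta U\in L^2(E_A)$ is characterized by $\sum_a\mathbf E[D_aF\,U_a]=\mathbf E[F\,\delta U]$ for all $F\in\mathbf D$. The condition $\delta V=0$ includes $V\in\operatorname{Dom}\delta$. *)

(* Defs.v *)
From HB Require Import structures.
From mathcomp Require Import all_boot all_order all_algebra finmap.
From mathcomp Require Import all_classical all_reals all_analysis.

Set Implicit Arguments.
Unset Strict Implicit.
Unset Printing Implicit Defensive.
Import Order.TTheory GRing.Theory Num.Theory.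
Import numFieldNormedType.Exports.

Local Open Scope classical_set_scope.
Local Open Scope ring_scope.

Definition polish (R : realType) (T : topologicalType) : Prop :=
  (exists d : T -> T -> R,
    [/\ (forall x y, 0 <= d x y),
        (forall x y, d x y = 0 <-> x = y),
        (forall x y, d x y = d y x) &
        (forall x y z, d x z <= d x y + d y z)] /\
    (forall (x : T) (B : set T),
       nbhs x B <-> exists2 e : R, 0 < e & [set y | d x y < e] `<=` B) /\
    (forall u : nat -> T,
       (forall e : R, 0 < e -> exists N : nat, forall m n : nat,
          (N <= m)%N -> (N <= n)%N -> d (u m) (u n) < e) ->
       exists l : T, u @ \oo --> l)) /\
  (exists2 S : set T, countable S & dense S).

(* Pointedness is only what the library asks of the base type of a generated
   sigma-algebra; it is no restriction, as these spaces carry probabilities. *)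
Definition borel (T : ptopologicalType) := g_sigma_algebraType (@open T).

Definition coord_events (A : countType) (E : A -> ptopologicalType) :
    set (set (forall a, E a)) :=
  [set C | exists a : A, exists2 B : set (borel (E a)),
     measurable B & C = [set x | B (x a)]].

Definition prod_space (A : countType) (E : A -> ptopologicalType) :=
  g_sigma_algebraType (@coord_events A E).

(* By the pi-lambda theorem, P is determined by these values. *)
Definition is_product_measure (R : realType) (A : countType)
    (E : A -> ptopologicalType) (Pa : forall a, probability (borel (E a)) R)
    (P : probability (prod_space E) R) : Prop :=
  forall (B : {fset A}) (C : forall a, set (borel (E a))),
    (forall a, measurable (C a)) ->
    P [set x | forall a, a \in B -> C a (x a)] =
    (\prod_(a <- B) Pa a (C a))%E.

(* Random variables are represented by functions on the product space;
   elements of L^2 are to be compared up to P-almost sure equality. *)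
Section MalliavinOperators.
Context (R : realType) (A : countType) (E : A -> ptopologicalType).
Context (Pa : forall a, probability (borel (E a)) R).
Context (P : probability (prod_space E) R).

Implicit Types (F G : prod_space E -> R) (U V : A -> prod_space E -> R).

Definition L2 F : Prop := F \in Lfun P 2%:E.

Definition sqnorm F : \bar R := (\int[P]_x (F x ^+ 2)%:E)%E.

Definition sqnorm_proc U : \bar R := (\esum_(a in [set: A]) sqnorm (U a))%E.

Definition L2_proc U : Prop :=
  (forall a, measurable_fun setT (U a)) /\ (sqnorm_proc U < +oo)%E.

Definition cylindrical F : Prop :=
  L2 F /\ exists B : {fset A}, forall x y : prod_space E,
    (forall a, a \in B -> x a = y a) -> F x = F y.

(* [dfwith x a y] is [x] with its coordinate of index [a] replaced by [y]. *)
Definition grad F (a : A) (x : prod_space E) : R :=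
  F x - \int[Pa a]_(y in [set: borel (E a)]) F (dfwith x a y).

Definition domD F : Prop :=
  L2 F /\ forall e : R, 0 < e -> exists2 G, cylindrical G &
    (sqnorm (F \- G)%R + sqnorm_proc (grad (F \- G)%R) < e%:E)%E.

Definition simple_process U : Prop :=
  (forall a, cylindrical (U a)) /\
  exists B : {fset A}, forall a, a \notin B -> U a = cst 0.

Definition sqnorm_Dl2 U : \bar R :=
  (\int[P]_x (\esum_(a in [set: A]) (`|U a x| ^+ 2)%:E) +
   \int[P]_x (\esum_(a in [set: A]) \esum_(b in [set: A])
                (`|grad (U b) a x| ^+ 2)%:E))%E.

Definition Dl2 U : Prop :=
  L2_proc U /\ forall e : R, 0 < e -> exists2 V, simple_process V &
    (sqnorm_Dl2 (fun a => (U a \- V a)%R) < e%:E)%E.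

(* The sum of an absolutely summable family of reals: [\esum] is meant for
   nonnegative families only. *)
Definition sumA (u : A -> R) : R :=
  fine (\esum_(a in [set: A]) (u^\+ a)%:E)%E -
  fine (\esum_(a in [set: A]) (u^\- a)%:E)%E.

Definition grad_pairing F U : R :=
  sumA (fun a => \int[P]_x (grad F a x * U a x)).

Definition domdelta U : Prop :=
  L2_proc U /\ exists2 c : R, 0 < c & forall F, domD F ->
    ((`|grad_pairing F U|)%:E <= c%:E * 'N[P]_2%:E[EFin \o F])%E.

(* delta as a graph: U is in Dom delta and delta U = G in L^2. *)
Definition is_divergence U G : Prop :=
  [/\ domdelta U, L2 G &
      forall F, domD F -> grad_pairing F U = \int[P]_x (F x * G x)].

Definition helmholtz U (phi : prod_space E -> R) V : Prop :=
  [/\ L2 phi, L2_proc V, \int[P]_x phi x = 0, is_divergence V (cst 0) &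
      forall a, {ae P, forall x, U a x = grad phi a x + V a x}].

End MalliavinOperators.

(* Main.v *)
Require Import Defs.
From mathcomp Require Import all_boot all_order all_algebra finmap.
From mathcomp Require Import all_classical all_reals all_analysis.
From mathcomp Require Import measurable_realfun ring lra.

(** The decomposition is the orthogonal projection of [U] onto the closure of
    the gradients of cylindrical functions. The gradient is injective with
    closed range on centered functions by the Efron-Stein (Poincare) inequality
    [Var F <= sum_a E[(D_a F)^2]], so a sequence [F_n] minimizing the distance
    of [D F_n] to [U] converges in L^2 to some [phi], and [U - D phi] is
    orthogonal to all gradients, i.e. has divergence [0].

    For uniqueness, test against [F = prod_(a in s) (1_(C a) (X_a) - P_a (C a))]
    with [s] finite: [D_a F = F] if [a] is in [s] and [D_a F = 0] otherwise.
    Since [D_a] is self-adjoint and [V] has divergence [0], this gives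
    [#|s| E[F phi] = sum_(a in s) E[F U_a]]: all these moments of [phi] are
    determined by [U], hence so are its integrals over rectangles. *)

Set Implicit Arguments.
Unset Strict Implicit.
Unset Printing Implicit Defensive.
Import Order.TTheory GRing.Theory Num.Theory.
Import numFieldNormedType.Exports.

Local Open Scope classical_set_scope.
Local Open Scope ring_scope.

(** * Semi-inner products *)

(** For [c > 0] evaluate the quadratic at its minimizer [- b / c]. The case [c = 0] has to be
    covered because the forms below are only semidefinite: an affine function bounded below is
    constant. *)
Lemma quad_ge0_discr (R : realType) (a b c : R) : 0 <= c ->
  (forall t, 0 <= a + 2 * t * b + t ^+ 2 * c) -> b ^+ 2 <= a * c.
Proof.
rewrite le_eqVlt => /predU1P[<- h|c0 h].
  rewrite mulr0; have [->|bN0] := eqVneq b 0; first by rewrite expr0n.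
  (* This [t] would make the affine function [a + 2 * t * b] equal to [-1]. *)
  have := h (- (a + 1) / (2 * b)).
  have -> : a + 2 * (- (a + 1) / (2 * b)) * b + (- (a + 1) / (2 * b)) ^+ 2 * 0
    = -1 by field; rewrite bN0.
  by rewrite lerNr oppr0 ler10.
have := h (- b / c).
have -> : a + 2 * (- b / c) * b + (- b / c) ^+ 2 * c = (a * c - b ^+ 2) / c.
  by field; rewrite gt_eqF.
by rewrite pmulr_lge0 ?invr_gt0// subr_ge0.
Qed.

Section semi_inner_product.
Context (R : realType) (V : lmodType R) (S : V -> Prop) (q : V -> V -> R).
Hypothesis SD : forall u v, S u -> S v -> S (u + v).
Hypothesis SZ : forall c u, S u -> S (c *: u).
Hypothesis qC : forall u v, q u v = q v u.
Hypothesis qD : forall u v w, S u -> S v -> S w -> q (u + v) w = q u w + q v w.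
Hypothesis qZ : forall c u w, S u -> S w -> q (c *: u) w = c * q u w.
Hypothesis q_ge0 : forall u, S u -> 0 <= q u u.

(** The predicate [S] is carried along because the instances of [q] are bilinear only on a subspace:
    square integrable functions for [inner], centered cylindrical functions for the energy. *)
Lemma form_addZ c u v : S u -> S v ->
  q (u + c *: v) (u + c *: v) = q u u + 2 * c * q u v + c ^+ 2 * q v v.
Proof.
move=> Su Sv; have Scv := SZ c Sv; have Sw := SD Su Scv.
rewrite qD// qZ// (qC u) (qC v) !qD// !qZ// (qC v u); ring.
Qed.

Lemma form_sub u v : S u -> S v ->
  q (u - v) (u - v) = q u u - 2 * q u v + q v v.
Proof. by move=> Su Sv; rewrite -scaleN1r form_addZ//; ring. Qed.

Lemma form_add_le2 u v : S u -> S v ->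
  q (u + v) (u + v) <= 2 * q u u + 2 * q v v.
Proof.
move=> Su Sv; have := q_ge0 (SD Su (SZ (-1) Sv)).
rewrite form_addZ// -[X in q (_ + X) (_ + X)]scale1r form_addZ//; lra.
Qed.

Lemma cauchy_schwarz_form u v : S u -> S v -> q u v ^+ 2 <= q u u * q v v.
Proof.
move=> Su Sv; apply: quad_ge0_discr; first exact: q_ge0.
by move=> t; rewrite -form_addZ//; apply: q_ge0; apply/SD/SZ.
Qed.

(* Riesz representation in the (possibly missing) completion of [(S, q)]: a
   minimizing sequence of [q u u - 2 * l u] is fast Cauchy by the parallelogram
   law, and satisfies the Euler-Lagrange equation in the limit. *)
Lemma riesz_sequence (l : V -> R) (C : R) (u0 : V) : S u0 ->
  (forall u v, S u -> S v -> l (u + v) = l u + l v) ->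
  (forall c u, S u -> l (c *: u) = c * l u) ->
  (forall u, S u -> - C <= q u u - 2 * l u) ->
  exists u : nat -> V, [/\ forall n, S (u n),
    forall n m, (n <= m)%N ->
      q (u m - u n) (u m - u n) <= 4 * 4^-1 ^+ n &
    forall n v, S v -> (q (u n) v - l v) ^+ 2 <= 4^-1 ^+ n * q v v].
Proof.
move=> Su0 lD lZ lb; pose J u := q u u - 2 * l u.
pose m := inf [set J u | u in S].
have JS : has_inf [set J u | u in S].
  split; first by exists (J u0), u0.
  by exists (- C) => _ [u Su <-]; exact: lb.
have mJ u : S u -> m <= J u by move=> Su; apply: ge_inf; [exact: JS.2|by exists u].
have e0 n : 0 < 4^-1 ^+ n :> R by rewrite exprn_gt0// invr_gt0 ltr0n.
have /choice[u uP] : forall n, exists v, S v /\ J v < m + 4^-1 ^+ n.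
  by move=> n; have [_ [v Sv <-] Jv] := inf_adherent (e0 n) JS; exists v.
exists u; split => [n|n k nk|n v Sv]; first exact: (uP n).1.
- have [[Sn Jn] [Sk Jk]] := (uP n, uP k).
  have enk : 4^-1 ^+ k <= 4^-1 ^+ n :> R.
    by rewrite ler_wiXn2l// ?invf_le1// ?ler1n.
  (* Parallelogram law: [J (u n) + J (u k)] minus twice [J] at the midpoint is half of
     [q (u k - u n) (u k - u n)]. Since [J] is at least [m] at the midpoint, this form is at most
     [2 * (4^-1 ^+ n + 4^-1 ^+ k)], whence the factor 4. *)
  have := mJ (2^-1 *: (u k + u n)) (SZ _ (SD Sk Sn)).
  have Skn := SD Sk Sn.
  rewrite /J qZ//; last exact: SZ.
  rewrite qC qZ// lZ// lD// -[X in q (_ + X) (_ + X)]scale1r form_addZ//.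
  move: Jn Jk; rewrite /J form_sub//.
  lra.
- have [Sn Jn] := uP n.
  (* Near-minimality, [J (u n) - 4^-1 ^+ n < m <= J (u n + t *: v)] for all [t], is nonnegativity of
     a quadratic in [t] with constant term [4^-1 ^+ n] and middle coefficient [q (u n) v - l v]. *)
  apply: quad_ge0_discr; first exact: q_ge0.
  move=> t; have := mJ (u n + t *: v) (SD Sn (SZ t Sv)).
  move: Jn; rewrite /J form_addZ// lD// ?lZ//; last exact: SZ.
  lra.
Qed.

End semi_inner_product.

(** Limits of inequalities are mostly taken through this lemma: each stage [n] is proved with a
    geometrically small error. *)
Lemma le0_geometric (R : realType) (x C z : R) : `|z| < 1 ->
  (forall n, x <= C * z ^+ n) -> x <= 0.
Proof.
move=> z1 xC; rewrite leNgt; apply/negP => x0.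
have /cvgrPdist_lt/(_ x x0)[N _ /(_ N (leqnn N))] := cvg_geometric C z1.
rewrite /= sub0r normrN => /(le_lt_trans (ler_norm _)).
by rewrite ltNge xC.
Qed.

(** The constant [C + 1] dominates the square root of [C] and keeps square roots out of the
    estimates. *)
Lemma sqr_le_geometric (R : realType) (x C : R) n : 0 <= C ->
  x ^+ 2 <= C * 4^-1 ^+ n -> `|x| <= (C + 1) * 2^-1 ^+ n.
Proof.
move=> C0; have w0 : 0 <= 2^-1 ^+ n :> R by rewrite exprn_ge0 ?invr_ge0.
have -> : 4^-1 ^+ n = (2^-1 ^+ n) ^+ 2 :> R.
  by rewrite -exprM mulnC exprM; congr (_ ^+ _); field.
rewrite -real_normK ?num_real// => xC.
have y0 : 0 <= (C + 1) * 2^-1 ^+ n by rewrite mulr_ge0 ?addr_ge0.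
rewrite -ler_sqr ?nnegrE ?normr_ge0//; apply: (le_trans xC).
by rewrite exprMn ler_wpM2r ?sqr_ge0//; nra.
Qed.

(** * The space L^2 of a probability *)

Section probability_facts.
Context d (T : measurableType d) (R : realType) (P : probability T R).

Lemma ae_imply (p q : T -> Prop) :
  {ae P, forall x, p x} -> (forall x, p x -> q x) -> {ae P, forall x, q x}.
Proof. by move=> hp pq; exact: filterS hp. Qed.

Lemma ae_imply2 (p q r : T -> Prop) :
  {ae P, forall x, p x} -> {ae P, forall x, q x} ->
  (forall x, p x -> q x -> r x) -> {ae P, forall x, r x}.
Proof. by move=> hp hq pqr; exact: filterS2 hp hq. Qed.

Lemma Rintegral_prob_cst (c : R) : \int[P]_x c = c.
Proof. by rewrite Rintegral_cst//= probability_setT mulr1. Qed.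

End probability_facts.

Section square_integrable.
Context d (T : measurableType d) (R : realType) (P : probability T R).
Implicit Types F G H : T -> R.
Local Notation L2 F := (F \in Lfun P 2%:E).

Lemma Lfun2P F :
  L2 F <-> measurable_fun setT F /\ (\int[P]_x (F x ^+ 2)%:E < +oo)%E.
Proof.
split=> [L2F|[mF iF]].
  have /integrableP[_] := Lfun2_integrable_sqr L2F.
  under eq_integral do rewrite /= ger0_norm ?sqr_ge0//.
  by move: L2F; rewrite inE => /andP[/[!inE] mF _].
rewrite inE; apply/andP; split; rewrite inE//= /finite_norm unlock /=.
rewrite poweR_lty//; under eq_integral do rewrite powR_mulrn// real_normK ?num_real//.
by [].
Qed.

Lemma Lfun2_measurable F : L2 F -> measurable_fun setT F.
Proof. by case/Lfun2P. Qed.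

Lemma Lfun2M F G : L2 F -> L2 G -> P.-integrable setT (fun x => (F x * G x)%:E).
Proof. by move=> LF LG; apply/(@Lfun1_integrable _ _ _ P (F \* G))/Lfun2_mul_Lfun1. Qed.

Lemma Lfun2D F G : L2 F -> L2 G -> L2 (F + G).
Proof.
have le12 : (1 <= 2%:E :> \bar R)%E by rewrite lee1n.
by move=> LF LG; exact: (@Lfun_addr_closed _ _ _ P _ le12).2.
Qed.

Lemma Lfun2Z c F : L2 F -> L2 (c *: F).
Proof.
move=> LF; rewrite (_ : c *: F = c \o* F); last first.
  by apply/funext => x /=; rewrite mulrC.
by apply: Lfun_scale; rewrite ?ler1n.
Qed.

Lemma Lfun2B F G : L2 F -> L2 G -> L2 (F - G).
Proof. by move=> LF LG; rewrite -scaleN1r; apply/Lfun2D/Lfun2Z. Qed.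

Lemma Lfun2_integrable F : L2 F -> P.-integrable setT (EFin \o F).
Proof.
move=> LF; have := Lfun2M LF (Lfun_cst P 1 2).
by apply: eq_integrable => // x _ /=; rewrite mulr1.
Qed.

Lemma Lfun2_bounded F (M : R) : measurable_fun setT F ->
  (forall x, `|F x| <= M) -> L2 F.
Proof.
move=> mF FM; apply/Lfun2P; split=> //.
apply: (@le_lt_trans _ _ (\int[P]_x (M ^+ 2)%:E)%E).
  apply: ge0_le_integral => //.
  - by move=> x _; rewrite lee_fin sqr_ge0.
  - by apply/measurable_EFinP; exact: measurable_funX.
  - move=> x _; rewrite lee_fin -real_normK ?num_real// ler_sqr ?nnegrE//.
    exact: le_trans (FM x).
by rewrite integral_cst//= probability_setT mule1 ltry.
Qed.

Definition inner F G : R := \int[P]_x (F x * G x).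
Local Notation dot := inner.

Lemma dotC F G : dot F G = dot G F.
Proof. by apply: eq_Rintegral => x _; rewrite mulrC. Qed.

Lemma dotDl F G H : L2 F -> L2 G -> L2 H -> dot (F + G) H = dot F H + dot G H.
Proof.
move=> LF LG LH; rewrite -RintegralD//; [|exact: Lfun2M..].
by apply: eq_Rintegral => x _; rewrite mulrDl.
Qed.

Lemma dotZl c F H : L2 F -> L2 H -> dot (c *: F) H = c * dot F H.
Proof.
move=> LF LH; rewrite -RintegralZl//; last exact: Lfun2M.
by apply: eq_Rintegral => x _; rewrite mulrA.
Qed.

Lemma dot0l H : dot 0 H = 0.
Proof.
by rewrite -[RHS](Rintegral_prob_cst P); apply: eq_Rintegral => x _; rewrite mul0r.
Qed.

Lemma dot_cst1 F : dot F (cst 1) = \int[P]_x F x.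
Proof. by apply: eq_Rintegral => x _; rewrite mulr1. Qed.

Lemma dotBl F G H : L2 F -> L2 G -> L2 H -> dot (F - G) H = dot F H - dot G H.
Proof.
by move=> LF LG LH; rewrite -scaleN1r dotDl ?dotZl ?mulN1r//; exact: Lfun2Z.
Qed.

Lemma dot_ge0 F : 0 <= dot F F.
Proof. by apply: Rintegral_ge0 => x _; rewrite -expr2 sqr_ge0. Qed.

Lemma eq_dotl F G H : L2 F -> L2 G -> L2 H -> {ae P, forall x, F x = G x} ->
  dot F H = dot G H.
Proof.
move=> LF LG LH FG; congr fine; apply: ae_eq_integral => //.
- by apply: (measurable_int P); exact: Lfun2M.
- by apply: (measurable_int P); exact: Lfun2M.
- by apply: filterS FG => x -> _.
Qed.

Lemma eq_dot F G : L2 F -> L2 G -> {ae P, forall x, F x = G x} ->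
  dot F F = dot G G.
Proof.
by move=> LF LG FG; rewrite (eq_dotl LF LG LF FG) dotC (eq_dotl LF LG LG FG).
Qed.

Lemma dotBB F G : L2 F -> L2 G ->
  dot (F - G) (F - G) = dot F F - 2 * dot F G + dot G G.
Proof.
exact: (form_sub Lfun2D Lfun2Z dotC dotDl dotZl).
Qed.

Lemma dotB_le2 F G : L2 F -> L2 G ->
  dot (F - G) (F - G) <= 2 * dot F F + 2 * dot G G.
Proof.
move=> LF LG; have LFG := Lfun2D LF LG; rewrite dotBB//.
have := dot_ge0 (F + G); rewrite dotDl// ![dot _ (F + G)]dotC !dotDl// (dotC G F).
lra.
Qed.

Lemma cauchy_schwarz F G : L2 F -> L2 G -> dot F G ^+ 2 <= dot F F * dot G G.
Proof.
exact: (cauchy_schwarz_form Lfun2D Lfun2Z dotC dotDl dotZl (fun u _ => dot_ge0 u)).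
Qed.

Lemma integral_sqr F : L2 F -> (\int[P]_x (F x ^+ 2)%:E = (dot F F)%:E)%E.
Proof.
move=> LF; rewrite /inner /Rintegral fineK//.
exact: integrable_fin_num (Lfun2M LF LF).
Qed.

Lemma dot_eq0 F : L2 F -> dot F F = 0 -> {ae P, forall x, F x = 0}.
Proof.
move=> LF F0; have : (\int[P]_x `|(F x ^+ 2)%:E| = 0)%E.
  under eq_integral do rewrite gee0_abs ?lee_fin ?sqr_ge0//.
  by rewrite integral_sqr// F0.
have mF2 : measurable_fun setT (fun x => (F x ^+ 2)%:E).
  by apply/measurable_EFinP/measurable_funX; exact: Lfun2_measurable LF.
move/(ae_eq_integral_abs _ measurableT mF2).
apply: filterS => x /(_ I) /= [] /eqP; rewrite sqrf_eq0 => /eqP; exact.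
Qed.

End square_integrable.

(** * Completeness of L^2 for geometrically Cauchy sequences *)

Section completeness.
Context d (T : measurableType d) (R : realType) (P : probability T R).
Local Notation L2 F := (F \in Lfun P 2%:E).
Local Notation dot := (inner P).

(** From [(2 ^+ k * |x| - 1) ^+ 2 >= 0] follows [|x| <= 2 ^+ k * x ^+ 2 + 2^-1 ^+ k], so the
    increments are absolutely summable. *)
Lemma cvg_of_sum_sqr_incr (u : nat -> R) (M : R) :
  (forall n, \sum_(0 <= k < n) 2 ^+ k * (u k.+1 - u k) ^+ 2 <= M) -> cvgn u.
Proof.
move=> uM.
suff sc : cvgn (series (telescope u)).
  rewrite (_ : u = cst (u 0%N) + series (telescope u)); last first.
    by apply/funext => n; rewrite [LHS]eq_sum_telescope.
  by apply: is_cvgD => //; exact: is_cvg_cst.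
apply: normed_cvg; apply: nondecreasing_is_cvgn.
  by apply: nondecreasing_series => n _ _ /=; exact: normr_ge0.
exists (M + 1 * (1 - 2^-1)^-1) => _ [n _ <-].
apply: (le_trans (_ : _ <= \sum_(0 <= k < n) 2 ^+ k * (u k.+1 - u k) ^+ 2 +
   series (geometric 1 2^-1) n)); last first.
  by rewrite lerD// geometric_le_lim// ?ger0_norm ?invr_ge0// invf_lt1// ltr1n.
rewrite /series /= -big_split /=; apply: ler_sum => k _.
rewrite /telescope /= mul1r exprVn.
set w := 2 ^+ k; set x := _ - _.
have w0 : 0 < w :> R by rewrite exprn_gt0.
have : 0 <= (w * `|x| - 1) ^+ 2 by rewrite sqr_ge0.
rewrite -(@real_normK _ x) ?num_real//.
have a0 := normr_ge0 x; move: a0; set a := `|x| => a0 h.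
rewrite -(ler_pM2r w0) mulrDl mulVf ?gt_eqF//.
have : 0 <= a * w by rewrite mulr_ge0// ltW.
nra.
Qed.

(** Riesz-Fischer: weighted square increments have finite total integral, so the sequence converges
    almost surely, and Fatou's lemma carries the Cauchy bound to the limit with the same rate. *)
Lemma Lfun2_complete (F : nat -> T -> R) (C : R) : 0 <= C ->
  (forall n, L2 (F n)) ->
  (forall n m, (n <= m)%N -> dot (F m - F n) (F m - F n) <= C * 4^-1 ^+ n) ->
  exists2 phi, L2 phi &
    forall n, dot (F n - phi) (F n - phi) <= C * 4^-1 ^+ n.
Proof.
move=> C0 LF cF.
(* The weight [2 ^+ k] gives pointwise convergence and still leaves integrals bounded by
   [C * 2^-1 ^+ k]. *)
pose f k x := (2 ^+ k * (F k.+1 x - F k x) ^+ 2)%:E.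
have f0 k x : (0 <= f k x)%E.
  by rewrite lee_fin; apply: mulr_ge0; [exact: exprn_ge0|exact: sqr_ge0].
have mF n : measurable_fun setT (F n) by exact: (Lfun2_measurable (LF n)).
have mf k : measurable_fun setT (f k).
  apply/measurable_EFinP; apply: measurable_funM => //.
  by apply: measurable_funX; exact: measurable_funB.
have int_f : (\int[P]_x (\sum_(k <oo) f k x) < +oo)%E.
  rewrite integral_nneseries//.
  apply: (@le_lt_trans _ _ (C * (1 - 2^-1)^-1)%:E); last exact: ltry.
  apply: lime_le; first by apply: is_cvg_nneseries => k _ _; exact: integral_ge0.
  apply: nearW => n.
  apply: (@le_trans _ _ (series (geometric C 2^-1) n)%:E); last first.
    by rewrite lee_fin geometric_le_lim// ?ger0_norm ?invr_ge0// invf_lt1// ltr1n.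
  rewrite /series /= -sumEFin; apply: lee_sum => k _.
  rewrite /f; under eq_integral do rewrite EFinM.
  rewrite ge0_integralZl//; last 2 first.
  - by apply/measurable_EFinP; apply: measurable_funX; exact: measurable_funB.
  - by move=> x _; rewrite lee_fin sqr_ge0.
  rewrite (@integral_sqr _ _ _ _ (F k.+1 - F k)); last exact: Lfun2B.
  rewrite -EFinM lee_fin.
  have -> : C * 2^-1 ^+ k = 2 ^+ k * (C * 4^-1 ^+ k).
    by rewrite mulrCA; congr (_ * _); rewrite -exprMn; congr (_ ^+ _); field.
  by rewrite ler_pM2l ?exprn_gt0//; exact: cF.
(* The upper limit exists and is measurable everywhere; [fine] replaces infinite values by 0, which
   concerns only a null set. *)
pose phi x := fine (limn_esup (fun n => (F n x)%:E)).
have mphi : measurable_fun setT phi.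
  apply: measurableT_comp => //; apply: measurable_fun_limn_esup => n.
  exact/measurable_EFinP.
have cvg_phi : {ae P, forall x, F n x @[n --> \oo] --> phi x}.
  have : P.-integrable setT (fun x => \sum_(k <oo) f k x)%E.
    apply/integrableP; split; first exact: ge0_emeasurable_sum.
    by under eq_integral do rewrite gee0_abs ?nneseries_ge0//.
  move/(integrable_ae measurableT); apply: filterS => x /(_ I) fx.
  have cF_x : cvgn (F ^~ x).
    apply: (@cvg_of_sum_sqr_incr _ (fine (\sum_(k <oo) f k x)%E)) => n.
    by rewrite -lee_fin fineK// -sumEFin; apply: nneseries_lim_ge => k _ _; exact: f0.
  suff -> : phi x = limn (F ^~ x) by [].
  have /cvg_limn_einf_sup[_] : (F n x)%:E @[n --> \oo] --> (limn (F ^~ x))%:E.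
    by apply: cvg_EFin => //; exact: nearW.
  by rewrite /phi => ->.
have bnd n : (\int[P]_x ((F n x - phi x) ^+ 2)%:E <= (C * 4^-1 ^+ n)%:E)%E.
  pose g m x := ((F n x - F m x) ^+ 2)%:E.
  have mg m : measurable_fun setT (g m).
    by apply/measurable_EFinP; apply: measurable_funX; exact: measurable_funB.
  have g0 m x : (0 <= g m x)%E by rewrite lee_fin sqr_ge0.
  apply: (@le_trans _ _ (\int[P]_x limn_einf (g ^~ x))%E).
    apply: ae_ge0_le_integral => //.
    - by move=> x _; rewrite lee_fin sqr_ge0.
    - by apply/measurable_EFinP; apply: measurable_funX; exact: measurable_funB.
    - move=> x _; rewrite limn_einf_lim; apply: lime_ge; first exact: is_cvg_einfs.
      by apply: nearW => k; apply: le_ereal_inf_tmp => _ [p _ <-].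
    - apply: measurableT_comp => //; apply: measurable_fun_limn_esup => m.
      exact: measurableT_comp.
    apply: filterS cvg_phi => x Fx _.
    have /cvg_limn_einf_sup[->//] :
        g m x @[m --> \oo] --> ((F n x - phi x) ^+ 2)%:E.
    apply: cvg_EFin; first exact: nearW.
    apply: cvgM; apply: cvgB => //; exact: cvg_cst.
  apply: (le_trans (fatou _ _ _ _)) => //.
  rewrite limn_einf_lim; apply: lime_le; first exact: is_cvg_einfs.
  (* The index [maxn k n] lies in the tail from [k], as the lower limit requires, and beyond [n], as
     the Cauchy bound requires. *)
  apply: nearW => k; apply: (@le_trans _ _ (\int[P]_x g (maxn k n) x)%E).
    by apply: ereal_inf_lbound; exists (maxn k n) => //=; exact: leq_maxl.
  rewrite /g (@integral_sqr _ _ _ _ (F n - F (maxn k n))); last exact: Lfun2B.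
  rewrite lee_fin -opprB.
  have : dot (F (maxn k n) - F n) (F (maxn k n) - F n) <= C * 4^-1 ^+ n.
    by apply: cF; exact: leq_maxr.
  apply: le_trans; rewrite le_eqVlt; apply/orP; left; apply/eqP.
  by apply: eq_Rintegral => x _ /=; rewrite mulrNN.
have LB n : L2 (F n - phi).
  apply/Lfun2P; split; first exact: measurable_funB.
  exact: le_lt_trans (bnd n) (ltry _).
exists phi; last by move=> n; rewrite -lee_fin -integral_sqr//; exact: bnd.
by rewrite -(subKr (F 0%N) phi); apply: Lfun2B.
Qed.

End completeness.

(** * Resampling one coordinate *)

Section product_space.
Context (R : realType) (A : countType) (E : A -> ptopologicalType).

Lemma measurable_coord (a : A) :
  measurable_fun setT (fun x : prod_space E => x a : borel (E a)).
Proof.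
move=> _ B mB; rewrite setTI; apply: sub_sigma_algebra.
by exists a; exists B.
Qed.

Lemma measurable_prod_space d (T : measurableType d) (f : T -> prod_space E) :
  (forall a, measurable_fun setT (fun t => f t a : borel (E a))) ->
  measurable_fun setT f.
Proof.
move=> mf.
have sub : preimage_set_system setT f (@coord_events A E) `<=` measurable.
  move=> _ [_ [a [B mB ->]] <-]; rewrite setTI.
  by have := mf a measurableT B mB; rewrite setTI.
exact: (@measurability _ _ T (prod_space E) setT f (@coord_events A E) erefl sub).
Qed.

Definition rect (B : {fset A}) (C : forall a, set (borel (E a))) :
    set (prod_space E) := [set x | forall a, a \in B -> C a (x a)].

Definition rects : set (set (prod_space E)) :=
  [set D | exists B C, (forall a, measurable (C a)) /\ D = rect B C].

Lemma measurable_rect B C : (forall a, measurable (C a)) -> measurable (rect B C).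
Proof.
move=> mC; rewrite (_ : rect B C =
  \bigcap_(a in [set` B]) [set x : prod_space E | C a (x a)]); last first.
  by apply/seteqP; split=> x Bx a aB; exact: Bx.
apply: fin_bigcap_measurable => [|a _]; first exact: finite_fset.
by have := @measurable_coord a measurableT _ (mC a); rewrite setTI.
Qed.

Lemma rects_setI : setI_closed rects.
Proof.
move=> _ _ [B [C [mC ->]]] [B' [C' [mC' ->]]].
exists (B `|` B')%fset, (fun a => (if a \in B then C a else setT) `&`
                           (if a \in B' then C' a else setT)); split.
  by move=> a; apply: measurableI; case: ifP.
apply/seteqP; split=> x.
  move=> [Bx B'x] a _; split; case: ifPn => // aB; [exact: Bx|exact: B'x].
move=> h; split=> a aB.
  by have /h[] : a \in (B `|` B')%fset; rewrite ?inE aB.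
by have /h[] : a \in (B `|` B')%fset; rewrite ?inE aB ?orbT.
Qed.

Lemma setT_rects : rects setT.
Proof.
exists fset0, (fun a => setT); split; first by move=> a.
by apply/seteqP; split=> // x _ a; rewrite inE.
Qed.

Lemma measurable_rects : @measurable _ (prod_space E) = <<s rects >>.
Proof.
apply/seteqP; split; last first.
  apply: smallest_sub; first exact: sigma_algebra_measurable.
  by move=> _ [B [C [mC ->]]]; exact: measurable_rect.
apply: sub_smallest2r; first exact: smallest_sigma_algebra.
move=> _ [a [B mB ->]].
exists [fset a]%fset, (dfwith (fun b => setT : set (borel (E b))) a B).
split; first by move=> b; case: dfwithP => // i _; exact: measurableT.
apply/seteqP; split=> x /=.
  by move=> Bx b; rewrite inE => /eqP ->; rewrite dfwithin.
by move=> /(_ a); rewrite dfwithin; apply; rewrite inE.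
Qed.

(** Uncurried, so that averaging over coordinate [a] becomes an inner integral for [P \x Pa a] and
    Fubini applies. *)
Definition resample (a : A) (z : prod_space E * borel (E a)) : prod_space E :=
  dfwith z.1 a z.2.

Lemma measurable_resample a : measurable_fun setT (@resample a).
Proof.
apply: measurable_prod_space => b; rewrite /resample.
have [<-|ab] := eqVneq a b.
  rewrite [X in measurable_fun _ X](_ : _ = snd); first exact: measurable_snd.
  by apply/funext => -[x y] /=; rewrite dfwithin.
rewrite [X in measurable_fun _ X](_ : _ = (fun x => x b) \o fst); last first.
  by apply/funext => t; exact: dfwithout.
exact: (@measurableT_comp _ _ _ _ _ _ (fun x : prod_space E => x b : borel (E b))
  setT fst (@measurable_coord b)).
Qed.

Lemma dfwith_dfwith (x : prod_space E) a (y z : E a) :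
  dfwith (dfwith x a y : prod_space E) a z = dfwith x a z.
Proof.
apply: functional_extensionality_dep => b.
have [ab|ab] := eqVneq a b; last by rewrite !dfwithout.
by subst b; rewrite !dfwithin.
Qed.

Context (Pa : forall a, probability (borel (E a)) R).
Context (P : probability (prod_space E) R).
Hypothesis P_product : is_product_measure Pa P.

Lemma resample_rect a B C : @resample a @^-1` (rect B C) =
  rect (B `\ a)%fset C `*` (if a \in B then C a else setT).
Proof.
apply/seteqP; split=> -[x y]; rewrite /rect /resample /=.
  move=> h; split=> [b|].
    rewrite !inE => /andP[ba bB]; have := h b bB.
    by rewrite dfwithout// eq_sym.
  by case: ifPn => // aB; have := h a aB; rewrite dfwithin.
move=> [h1 h2] b bB; have [ab|ab] := eqVneq a b.
  by subst b; rewrite dfwithin; rewrite bB in h2.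
by rewrite dfwithout//; apply: h1; rewrite !inE bB eq_sym ab.
Qed.

Lemma P_rect B C : (forall a, measurable (C a)) ->
  P (rect B C) = (\prod_(a <- B) Pa a (C a))%E.
Proof. exact: P_product. Qed.

(* Resampling one coordinate preserves [P]. *)
Lemma resample_preserves a (D : set (prod_space E)) : measurable D ->
  P D = pushforward (P \x Pa a)%E (@resample a) D.
Proof.
have mr := @measurable_resample a; move: D.
apply: (measure_unique rects (fun=> setT) measurable_rects rects_setI
  (fun=> setT_rects) _ P (pushforward (P \x Pa a)%E (@resample a))) => //.
- by apply/seteqP; split=> // x _; exists 0%N.
- move=> _ [B [C [mC ->]]]; rewrite /= /pushforward resample_rect.
  rewrite product_measure1E//; [|exact: measurable_rect|].
    2: by case: ifP => _; [exact: mC|exact: measurableT].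
  rewrite P_rect// [X in _ = (X * _)%E](P_rect (B `\ a)%fset mC)//.
  case: ifPn => aB; first by rewrite (big_fsetD1 a)// muleC.
  rewrite [X in _ = (_ * X)%E](probability_setT (Pa a)) mule1.
  suff -> : (B `\ a)%fset = B by [].
  by apply/fsetP => b; rewrite !inE; case: eqVneq aB => // -> /negbTE ->.
- by move=> _; exact: le_lt_trans (probability_le1 P measurableT) (ltry _).
Qed.

Lemma ge0_integral_resample a (f : prod_space E -> \bar R) :
  measurable_fun setT f -> (forall x, 0 <= f x)%E ->
  (\int[P]_x f x = \int[P]_x \int[Pa a]_y f (dfwith x a y))%E.
Proof.
move=> mf f0.
rewrite (eq_measure_integral (pushforward (P \x Pa a)%E (@resample a)));
  [exact: measurable_resample|move=> mr|
   by move=> mr D mD _; exact: resample_preserves].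
rewrite ge0_integral_pushforward//.
rewrite preimage_setT fubini_tonelli1//.
  by apply: measurableT_comp => //; exact: measurable_resample.
by move=> z; exact: f0.
Qed.

(** Change of variables along [resample], then Fubini. Integrability on the product is part of the
    conclusion because it yields measurability of the averages and integrability on almost every
    fiber. *)
Lemma integral_resample a (f : prod_space E -> \bar R) : P.-integrable setT f ->
  (P \x Pa a)%E.-integrable setT (f \o @resample a) /\
  (\int[P]_x f x = \int[P]_x \int[Pa a]_y f (dfwith x a y))%E.
Proof.
move=> /integrableP[mf fi].
have mfr : measurable_fun setT (f \o @resample a).
  by apply: measurableT_comp => //; exact: measurable_resample.
have ir : (P \x Pa a)%E.-integrable setT (f \o @resample a).
  apply/integrable12ltyP => //.
  have := @ge0_integral_resample a (abse \o f); rewrite /= => <- //.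
  exact: measurableT_comp.
split=> //.
rewrite (eq_measure_integral (pushforward (P \x Pa a)%E (@resample a)));
  [exact: measurable_resample|move=> mr|
   by move=> mr D mD _; exact: resample_preserves].
rewrite integral_pushforward//.
by rewrite preimage_setT -integral12_prod_meas1.
Qed.

End product_space.

(** * Averaging over one coordinate and the gradient *)

Section cexp.
Context (R : realType) (A : countType) (E : A -> ptopologicalType).
Context (Pa : forall a, probability (borel (E a)) R).
Context (P : probability (prod_space E) R).
Hypothesis P_product : is_product_measure Pa P.
Implicit Types F G H : prod_space E -> R.
Local Notation dot := (inner P).
Local Notation grad := (grad Pa).

(** The conditional expectation given all coordinates other than [a], in the pointwise version that
    appears inside [grad]. *)
Definition cexp F (a : A) (x : prod_space E) : R :=
  \int[Pa a]_(y in [set: borel (E a)]) F (dfwith x a y).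

Lemma gradE F a : grad F a = F - cexp F a.
Proof. by []. Qed.

Lemma cexp_dfwith F a x y : cexp F a (dfwith x a y) = cexp F a x.
Proof. by apply: eq_Rintegral => z _; rewrite dfwith_dfwith. Qed.

Lemma cexp_cst (c : R) a : cexp (cst c) a = cst c.
Proof.
by apply/funext => x; exact: Rintegral_prob_cst.
Qed.

Lemma measurable_fiber F a x : measurable_fun setT F ->
  measurable_fun setT (fun y : borel (E a) => F (dfwith x a y)).
Proof.
move=> mF; apply: (@measurableT_comp _ _ _ _ _ _ (F \o @resample A E a) setT (pair x)).
  exact: (measurableT_comp mF (@measurable_resample A E a)).
exact: pair1_measurable.
Qed.

(** Cauchy-Schwarz against the constant 1 on the fiber through [x]. On a fiber where [F] is not
    square integrable the right-hand side is infinite. *)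
Lemma cexp_sqr_le F a x : measurable_fun setT F ->
  ((cexp F a x ^+ 2)%:E <=
   \int[Pa a]_(y in [set: borel (E a)]) (F (dfwith x a y) ^+ 2)%:E)%E.
Proof.
move=> mF; set I := (X in (_ <= X)%E).
have [Ioo|Ifin] := leP (+oo)%E I; first exact: le_trans (leey _) Ioo.
have LF : (fun y : borel (E a) => F (dfwith x a y)) \in Lfun (Pa a) 2%:E.
  by apply/Lfun2P; split=> //; exact: measurable_fiber.
have L1 : (cst 1 : borel (E a) -> R) \in Lfun (Pa a) 2%:E by exact: Lfun_cst.
rewrite /I (integral_sqr LF) lee_fin.
have := cauchy_schwarz LF L1.
have -> : inner (Pa a) (cst 1) (cst 1) = 1.
  by rewrite dot_cst1; exact: Rintegral_prob_cst.
rewrite mulr1; congr (_ ^+ 2 <= _).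
by apply: eq_Rintegral => y _; rewrite mulr1.
Qed.

Lemma measurable_cexp F a : L2 P F -> measurable_fun setT (cexp F a).
Proof.
move=> LF; apply: measurableT_comp => //.
have [iF _] := integral_resample P_product a (Lfun2_integrable LF).
exact: (measurable_fubini_F iF).
Qed.

Lemma cexp_Lfun2 F a : L2 P F -> L2 P (cexp F a).
Proof.
move=> LF; have mF := Lfun2_measurable LF.
apply/Lfun2P; split; first exact: measurable_cexp.
have [_] := (Lfun2P P F).1 LF; apply: le_lt_trans.
have mF2 : measurable_fun setT (fun x => (F x ^+ 2)%:E).
  by apply/measurable_EFinP/measurable_funX.
rewrite [leRHS](ge0_integral_resample P_product a)//; last first.
  by move=> x; rewrite lee_fin sqr_ge0.
apply: ge0_le_integral => //.
- by move=> x _; rewrite lee_fin sqr_ge0.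
- by apply/measurable_EFinP/measurable_funX; exact: measurable_cexp.
- have [iF _] := integral_resample P_product a (Lfun2M LF LF).
  exact: (measurable_fubini_F iF).
- by move=> x _; exact: cexp_sqr_le.
Qed.

Lemma ae_fiber_Lfun2 F a : L2 P F ->
  {ae P, forall x, (fun y : borel (E a) => F (dfwith x a y)) \in Lfun (Pa a) 2%:E}.
Proof.
move=> LF; have [] := integral_resample P_product a (Lfun2M LF LF).
move=> /ae_integrable1 h _; apply: (ae_imply h) => x /integrableP[_ Fx].
apply/Lfun2P; split; first by apply: measurable_fiber; exact: (Lfun2_measurable LF).
by move: Fx; under eq_integral do rewrite gee0_abs ?lee_fin -?expr2 ?sqr_ge0//.
Qed.

(* [cexp ^~ a] is an orthogonal projection. *)
Lemma dot_cexp F G a : L2 P F -> L2 P G ->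
  dot G (cexp F a) = dot (cexp G a) (cexp F a).
Proof.
move=> LF LG; have LcF := cexp_Lfun2 a LF; have LcG := cexp_Lfun2 a LG.
have iGF := Lfun2M LG LcF.
have [/measurable_fubini_F mI eI] := integral_resample P_product a iGF.
rewrite /inner /Rintegral eI; congr fine; apply: ae_eq_integral => //.
  by apply: (measurable_int P); exact: Lfun2M.
apply: (ae_imply (ae_fiber_Lfun2 a LG)) => x Gx _.
(* [cexp F a] is constant along the fiber and factors out of the inner integral. *)
under eq_integral do rewrite cexp_dfwith EFinM.
rewrite integralZr//; last exact: Lfun2_integrable.
rewrite EFinM /cexp /Rintegral [in RHS]fineK//.
exact: (integrable_fin_num _ (Lfun2_integrable Gx)).
Qed.

(** Linearity holds only almost surely: on an exceptional fiber where [F] or [G] is not integrable,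
    the integrals take conventional values. *)
Lemma cexp_addZ F G c a : L2 P F -> L2 P G ->
  {ae P, forall x, cexp (F + c *: G) a x = (cexp F a + c *: cexp G a) x}.
Proof.
move=> LF LG; apply: (ae_imply2 (ae_fiber_Lfun2 a LF) (ae_fiber_Lfun2 a LG)).
move=> x Fx Gx; rewrite /cexp.
rewrite [RHS](_ : _ = \int[Pa a]_(y in [set: borel (E a)]) F (dfwith x a y) +
  c * \int[Pa a]_(y in [set: borel (E a)]) G (dfwith x a y))//.
rewrite -RintegralZl//; last exact: Lfun2_integrable.
rewrite -RintegralD//; first exact: Lfun2_integrable.
exact: Lfun2_integrable (Lfun2Z c Gx).
Qed.

Lemma grad_Lfun2 F a : L2 P F -> L2 P (grad F a).
Proof. by move=> LF; rewrite gradE; apply: Lfun2B => //; exact: cexp_Lfun2. Qed.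

Lemma grad_addZ F G c a : L2 P F -> L2 P G ->
  {ae P, forall x, grad (F + c *: G) a x = (grad F a + c *: grad G a) x}.
Proof.
move=> LF LG; apply: (ae_imply (cexp_addZ c a LF LG)) => x.
rewrite !gradE !fctE => ->; rewrite /=; ring.
Qed.

Lemma dot_gradDZl F G c a H : L2 P F -> L2 P G -> L2 P H ->
  dot (grad (F + c *: G) a) H = dot (grad F a) H + c * dot (grad G a) H.
Proof.
move=> LF LG LH; have LFa := grad_Lfun2 a LF; have LGa := grad_Lfun2 a LG.
rewrite (eq_dotl _ _ LH (grad_addZ c a LF LG)).
- by rewrite dotDl ?dotZl//; exact: Lfun2Z.
- by apply: grad_Lfun2; apply: Lfun2D => //; exact: Lfun2Z.
- by apply: Lfun2D => //; exact: Lfun2Z.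
Qed.

Lemma dot_gradBl F G a H : L2 P F -> L2 P G -> L2 P H ->
  dot (grad (F - G) a) H = dot (grad F a) H - dot (grad G a) H.
Proof. by move=> LF LG LH; rewrite -scaleN1r dot_gradDZl// mulN1r. Qed.

Lemma dot_grad F a : L2 P F ->
  dot (grad F a) (grad F a) = dot F F - dot (cexp F a) (cexp F a).
Proof.
move=> LF; have LcF := cexp_Lfun2 a LF.
by rewrite gradE dotBB// dot_cexp//; ring.
Qed.

Lemma dot_grad_le F a : L2 P F -> dot (grad F a) (grad F a) <= dot F F.
Proof. by move=> LF; rewrite dot_grad// gerBl dot_ge0. Qed.

Lemma dot_cexp_le F a : L2 P F -> dot (cexp F a) (cexp F a) <= dot F F.
Proof. by move=> LF; rewrite -subr_ge0 -dot_grad// dot_ge0. Qed.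

Lemma mean_cexp F a : L2 P F -> dot (cexp F a) (cst 1) = dot F (cst 1).
Proof.
move=> LF; have L1 : L2 P (cst 1) by exact: Lfun_cst.
by have := dot_cexp a L1 LF; rewrite !cexp_cst.
Qed.

(** The condition inside [cylindrical] with its finite set exposed: by [grad_depends], sums of
    gradient terms then run over [B]. *)
Definition depends F (B : {fset A}) :=
  forall x y : prod_space E, (forall a, a \in B -> x a = y a) -> F x = F y.

Lemma dependsW F (B B' : {fset A}) : (B `<=` B')%fset -> depends F B -> depends F B'.
Proof.
by move=> /fsubsetP BB' FB x y xy; apply: FB => a /BB'; exact: xy.
Qed.

Lemma depends_addZ F G c B : depends F B -> depends G B -> depends (F + c *: G) B.
Proof. by move=> FB GB x y xy; rewrite !fctE (FB x y xy) (GB x y xy). Qed.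

Lemma cexp_depends F a B : depends F B -> depends (cexp F a) (B `\ a)%fset.
Proof.
move=> FB x y xy; apply: eq_Rintegral => z _; apply: FB => b bB.
have [ab|ab] := eqVneq a b; first by subst b; rewrite !dfwithin.
by rewrite !dfwithout//; apply: xy; rewrite !inE eq_sym ab.
Qed.

Lemma grad_depends F a B : depends F B -> a \notin B -> grad F a = cst 0.
Proof.
move=> FB aB; apply/funext => x; rewrite gradE !fctE.
have -> : cexp F a x = F x; last by rewrite subrr.
rewrite -[RHS](Rintegral_prob_cst (Pa a)); apply: eq_Rintegral => y _.
apply: FB => b bB; rewrite dfwithout//.
by apply: contraNneq aB => ->.
Qed.

Lemma cylindrical_addZ F G c : cylindrical P F -> cylindrical P G ->
  cylindrical P (F + c *: G).
Proof.
move=> [LF [B FB]] [LG [B' GB]]; split; first by apply: Lfun2D => //; exact: Lfun2Z.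
exists (B `|` B')%fset; apply: depends_addZ.
  exact: dependsW (fsubsetUl _ _) FB.
exact: dependsW (fsubsetUr _ _) GB.
Qed.

Lemma cylindrical_cst c : cylindrical P (cst c).
Proof. by split; [exact: Lfun_cst|exists fset0]. Qed.

Definition cexps (s : seq A) F := foldr (fun a G => cexp G a) F s.

Lemma cexps_Lfun2 s F : L2 P F -> L2 P (cexps s F).
Proof. by move=> LF; elim: s => //= a s; exact: cexp_Lfun2. Qed.

Lemma mean_cexps s F : L2 P F -> dot (cexps s F) (cst 1) = dot F (cst 1).
Proof.
by move=> LF; elim: s => //= a s <-; rewrite mean_cexp//; exact: cexps_Lfun2.
Qed.

Lemma cexps_depends s F B : depends F B ->
  depends (cexps s F) [fset a in B | a \notin s]%fset.
Proof.
move=> FB; elim: s => [|a s IH] /=.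
  by apply: dependsW FB; apply/fsubsetP => b; rewrite !inE andbT.
apply: dependsW (cexp_depends (a := a) IH); apply/fsubsetP => b.
by rewrite !inE negb_or => /andP[-> /andP[-> ->]].
Qed.

(* [F - E_a G = (F - E_a F) + E_a (F - G)] is an orthogonal decomposition. *)
Lemma efron_stein s F : L2 P F ->
  dot (F - cexps s F) (F - cexps s F) <= \sum_(a <- s) dot (grad F a) (grad F a).
Proof.
move=> LF; elim: s => [|a s IH] /=; first by rewrite big_nil subrr dot0l.
rewrite big_cons; have LG := cexps_Lfun2 s LF; set G := cexps s F in IH LG *.
have LcF := cexp_Lfun2 a LF; have LcG := cexp_Lfun2 a LG.
have LFG := Lfun2B LF LG; have LcFG := cexp_Lfun2 a LFG.
have LgF := grad_Lfun2 a LF.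
have -> : dot (F - cexp G a) (F - cexp G a) =
   dot (grad F a + cexp (F - G) a) (grad F a + cexp (F - G) a).
  apply: eq_dot; [exact: Lfun2B|exact: Lfun2D|].
  apply: (ae_imply (cexp_addZ (-1) a LF LG)) => x.
  rewrite scaleN1r => e.
  rewrite [RHS](_ : _ = F x - cexp F a x + cexp (F - G) a x)// e.
  rewrite [RHS](_ : _ = F x - cexp F a x + (cexp F a x + -1 * cexp G a x))//.
  by rewrite [LHS](_ : _ = F x - cexp G a x)//; ring.
rewrite -[X in dot (_ + X) (_ + X)]scale1r.
rewrite (form_addZ (@Lfun2D _ _ _ P) (@Lfun2Z _ _ _ P) (dotC P)
  (@dotDl _ _ _ P) (@dotZl _ _ _ P))//.
(* The cross term vanishes: a gradient in direction [a] is orthogonal to the range of the projection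
   [cexp ^~ a]. *)
have -> : dot (grad F a) (cexp (F - G) a) = 0.
  by rewrite gradE dotBl// dot_cexp// subrr.
by rewrite mulr0 addr0 expr1n mul1r lerD2l (le_trans (dot_cexp_le _ _)).
Qed.

(** Averaging over all coordinates in [B] leaves a constant, which is the mean of [F], hence 0; then
    [efron_stein] applies with [s = B]. *)
Lemma poincare F B : L2 P F -> depends F B -> dot F (cst 1) = 0 ->
  dot F F <= \sum_(a <- B) dot (grad F a) (grad F a).
Proof.
move=> LF FB F0; suff c0 : cexps B F = 0.
  by have := efron_stein B LF; rewrite c0 subr0.
have cB x y : cexps B F x = cexps B F y.
  by apply: (cexps_depends (s := B) FB) => a; rewrite !inE => /andP[->].
apply/funext => x; rewrite -[RHS]F0 -(mean_cexps B LF) dot_cst1.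
by rewrite -[LHS](Rintegral_prob_cst P); apply: eq_Rintegral => y _; exact: cB.
Qed.

End cexp.

(** * Projection onto gradients *)

Section existence.
Context (R : realType) (A : countType) (E : A -> ptopologicalType).
Context (Pa : forall a, probability (borel (E a)) R).
Context (P : probability (prod_space E) R).
Hypothesis P_product : is_product_measure Pa P.
Implicit Types (F G H : prod_space E -> R) (W : A -> prod_space E -> R).
Local Notation dot := (inner P).
Local Notation grad := (grad Pa).

Lemma dot_gradB_le2 F G a : L2 P F -> L2 P G ->
  dot (grad (F - G) a) (grad (F - G) a) <=
  2 * dot (grad F a) (grad F a) + 2 * dot (grad G a) (grad G a).
Proof.
move=> LF LG; have LFa := grad_Lfun2 P_product a LF.
have LGa := grad_Lfun2 P_product a LG; have LFG := Lfun2B LF LG.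
rewrite (eq_dot (G := grad F a - grad G a)); first exact: dotB_le2 LFa LGa.
- exact: grad_Lfun2.
- exact: Lfun2B LFa LGa.
- by have := grad_addZ P_product (-1) a LF LG; rewrite !scaleN1r.
Qed.

(** A finitely supported sum, meaningful for cylindrical [F]. It names no finite set, so it can
    serve as a form in [riesz_sequence]; with [W = grad G] it is the Dirichlet form, called energy
    below. *)
Definition pairing F W : R := \sum_(a \in [set: A]) dot (grad F a) (W a).

Lemma pairingE F W (B : {fset A}) : depends F B ->
  pairing F W = \sum_(a <- B) dot (grad F a) (W a).
Proof.
move=> FB; apply: fsbigTE => a aB.
by rewrite (grad_depends Pa FB aB); exact: dot0l.
Qed.

Lemma pairing_addZ F G c W : cylindrical P F -> cylindrical P G ->
  (forall a, L2 P (W a)) -> pairing (F + c *: G) W = pairing F W + c * pairing G W.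
Proof.
move=> [LF [B FB]] [LG [B' GB]] LW.
have FBB := dependsW (fsubsetUl B B') FB; have GBB := dependsW (fsubsetUr B B') GB.
rewrite (pairingE _ (depends_addZ c FBB GBB)) (pairingE _ FBB) (pairingE _ GBB).
rewrite mulr_sumr -big_split /=; apply: eq_bigr => a _.
exact: dot_gradDZl.
Qed.

Lemma pairingD F G W : cylindrical P F -> cylindrical P G ->
  (forall a, L2 P (W a)) -> pairing (F + G) W = pairing F W + pairing G W.
Proof. by move=> cF cG LW; rewrite -[G in LHS]scale1r pairing_addZ// mul1r. Qed.

Lemma pairingZ F c W : cylindrical P F ->
  (forall a, L2 P (W a)) -> pairing (c *: F) W = c * pairing F W.
Proof.
move=> cF LW; have := pairing_addZ c (cylindrical_cst P 0) cF LW.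
rewrite (_ : cst 0 + c *: F = c *: F) ?add0r// => ->.
rewrite (pairingE _ (B := fset0)) ?big_seq_fset0 ?add0r//.
Qed.

Lemma energyC F G : pairing F (grad G) = pairing G (grad F).
Proof. by apply: eq_fsbigr => a _; rewrite dotC. Qed.

Lemma energy_ge0 F : 0 <= pairing F (grad F).
Proof. by apply: fsumr_ge0 => a _; exact: dot_ge0. Qed.

Lemma energy_ge F (B : {fset A}) : cylindrical P F ->
  \sum_(a <- B) dot (grad F a) (grad F a) <= pairing F (grad F).
Proof.
move=> [LF [B' FB]]; rewrite (pairingE _ (dependsW (fsubsetUr B B') FB)).
pose f a := if a \in B then dot (grad F a) (grad F a) else 0.
rewrite (eq_big_seq f) => [|a aB]; last by rewrite /f aB.
rewrite (big_fset_incl _ (fsubsetUl B B')); last by move=> a _ /negbTE; rewrite /f => ->.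
by apply: ler_sum => a _; rewrite /f; case: ifP => // _; exact: dot_ge0.
Qed.

(** On these functions the energy dominates the squared L^2 norm, so energy-Cauchy sequences
    converge in L^2. *)
Definition centered F := cylindrical P F /\ dot F (cst 1) = 0.

Let L1 : L2 P (cst 1). Proof. exact: Lfun_cst. Qed.

Lemma centeredD F G : centered F -> centered G -> centered (F + G).
Proof.
move=> [cF F0] [cG G0]; split; last first.
  by rewrite dotDl ?F0 ?G0 ?addr0//; [case: cF|case: cG].
by rewrite -[G]scale1r; exact: cylindrical_addZ.
Qed.

Lemma centeredZ c F : centered F -> centered (c *: F).
Proof.
move=> [cF F0]; split; last by rewrite dotZl ?F0 ?mulr0//; case: cF.
rewrite -[c *: F]add0r; exact: cylindrical_addZ (cylindrical_cst P 0) cF.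
Qed.

(** Constants have gradient 0, so test functions may be centered. Gradients are compared through
    inner products because [grad] is additive only almost surely. *)
Lemma centered_sub_mean F (B : {fset A}) : L2 P F -> depends F B ->
  exists G, [/\ centered G, depends G B & forall a H, L2 P H ->
    dot (grad G a) H = dot (grad F a) H].
Proof.
move=> LF FB; pose m : prod_space E -> R := cst (dot F (cst 1)).
have Lm : L2 P m by exact: Lfun_cst.
have mB C : depends m C by [].
have FmB : depends (F - m) B by rewrite -scaleN1r; exact: depends_addZ.
exists (F - m); split; [split|exact: FmB|].
- by split; [exact: Lfun2B|exists B].
- by rewrite dotBl// (dot_cst1 P m) Rintegral_prob_cst subrr.
- move=> a H LH; rewrite dot_gradBl// (grad_depends Pa (mB fset0))//.
  by rewrite (dot0l P H) subr0.
Qed.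

Lemma centered_poincare F : centered F -> dot F F <= pairing F (grad F).
Proof.
move=> [[LF [B FB]] F0]; rewrite (pairingE _ FB).
exact: poincare.
Qed.

(** [riesz_sequence] is applied to the energy and [l F = pairing F W]. The limit [phi] need not be
    cylindrical, so its energy bound and the orthogonality are expressed by finite sums. *)
Lemma gradient_projection W (M : R) : (forall a, L2 P (W a)) ->
  (forall B : {fset A}, \sum_(a <- B) dot (W a) (W a) <= M) ->
  exists phi, [/\ L2 P phi, dot phi (cst 1) = 0,
    exists K, forall B : {fset A},
      \sum_(a <- B) dot (grad phi a) (grad phi a) <= K &
    forall F (B : {fset A}), L2 P F -> depends F B ->
      \sum_(a <- B) dot (grad F a) (W a - grad phi a) = 0].
Proof.
move=> LW WM.
have Lg F : centered F -> forall a, L2 P (grad F a).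
  by move=> [[LF _] _] a; exact: grad_Lfun2.
have lb F : centered F -> - M <= pairing F (grad F) - 2 * pairing F W.
  move=> [[LF [B FB]] _]; rewrite !(pairingE _ FB) mulr_sumr -sumrB.
  (* Completing the square term by term: the form of [grad F a - W a] is nonnegative. *)
  apply: (@le_trans _ _ (- \sum_(a <- B) dot (W a) (W a))); first by rewrite lerN2.
  rewrite -sumrN; apply: ler_sum => a _; rewrite -subr_ge0 opprK.
  by rewrite -(dotBB (grad_Lfun2 P_product a LF) (LW a)) dot_ge0.
have c0 : centered 0 by split; [exact: cylindrical_cst|exact: dot0l].
have energyD F G H : centered F -> centered G -> centered H ->
    pairing (F + G) (grad H) = pairing F (grad H) + pairing G (grad H).
  by move=> [cF _] [cG _] cH; apply: pairingD => //; exact: Lg.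
have energyZ c F H : centered F -> centered H ->
    pairing (c *: F) (grad H) = c * pairing F (grad H).
  by move=> [cF _] cH; apply: pairingZ => //; exact: Lg.
have [u [cu u_cauchy u_weak]] := riesz_sequence centeredD centeredZ energyC
  energyD energyZ (fun F _ => energy_ge0 F) (l := pairing^~ W) c0
  (fun F G cF cG => pairingD cF.1 cG.1 LW) (fun c F cF => pairingZ c cF.1 LW) lb.
have Lu n : L2 P (u n) := (cu n).1.1.
have cB n m : centered (u m - u n).
  by rewrite -scaleN1r; apply: centeredD (cu m) (centeredZ _ (cu n)).
have [||phi Lphi uphi] := Lfun2_complete (C := 4) _ Lu.
- by [].
- move=> n m nm; apply: le_trans (u_cauchy n m nm).
  exact: centered_poincare.
have z4 : `|4^-1| < 1 :> R by rewrite ger0_norm ?invr_ge0// invf_lt1 ?ltr1n.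
have z2 : `|2^-1| < 1 :> R by rewrite ger0_norm ?invr_ge0// invf_lt1 ?ltr1n.
have LB n : L2 P (u n - phi) by exact: Lfun2B (Lu n) Lphi.
(* Each [grad _ a] is an L^2 contraction, so it inherits the rate of convergence of [u n] to
   [phi]. *)
have grad_cvg n a : dot (grad (u n - phi) a) (grad (u n - phi) a) <= 4 * 4^-1 ^+ n.
  exact: le_trans (dot_grad_le P_product a (LB n)) (uphi n).
exists phi; split=> //.
- apply/eqP; rewrite -normr_le0; apply: (@le0_geometric _ _ (4 + 1) _ z2) => n.
  apply: sqr_le_geometric => //; apply: le_trans (uphi n).
  have := cauchy_schwarz (LB n) L1.
  have -> : dot (u n - phi) (cst 1) = - dot phi (cst 1).
    by rewrite (dotBl (Lu n) Lphi L1) [X in X - _](cu n).2 sub0r.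
  rewrite sqrrN; have -> : dot (cst 1) (cst 1) = 1.
    by rewrite (dot_cst1 P (cst 1)); exact: Rintegral_prob_cst.
  by rewrite mulr1.
(* The energies of [u n] are bounded, since those of [u n - u 0%N] are at most 4. The bound passes
   to [phi] on each finite [B] by writing [phi = u n - (u n - phi)]. *)
- have [K uK] : exists K, forall n, pairing (u n) (grad (u n)) <= K.
    exists (2 * 4 + 2 * pairing (u 0%N) (grad (u 0%N))) => n.
    have -> : u n = (u n - u 0%N) + u 0%N by rewrite subrK.
    apply: le_trans (form_add_le2 centeredD centeredZ energyC
      energyD energyZ (fun F _ => energy_ge0 F) (cB 0%N n) (cu 0%N)) _.
    rewrite lerD2r ler_pM2l// (le_trans (u_cauchy 0%N n _))//.
    by rewrite expr0 mulr1.
  exists (2 * K) => B; rewrite -subr_le0.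
  apply: (@le0_geometric _ _ (\sum_(a <- B) 8) _ z4) => n.
  rewrite lerBlDr.
  apply: (@le_trans _ _ (\sum_(a <- B) (2 * dot (grad (u n) a) (grad (u n) a) +
      2 * dot (grad (u n - phi) a) (grad (u n - phi) a)))).
    apply: ler_sum => a _; have := dot_gradB_le2 a (Lu n) (LB n).
    by rewrite subKr.
  rewrite big_split /= addrC lerD//.
    apply: (@le_trans _ _ (\sum_(a <- B) 8 * 4^-1 ^+ n)).
      apply: ler_sum => a _; have := grad_cvg n a; lra.
    by rewrite mulr_suml.
  rewrite -mulr_sumr ler_pM2l//; apply: le_trans (energy_ge B (cu n).1) (uK n).
- move=> F0 B LF0 F0B.
  have [F [cF FB gF]] := centered_sub_mean LF0 F0B.
  rewrite (eq_bigr (fun a => dot (grad F a) (W a - grad phi a))); last first.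
    by move=> a _; rewrite gF//; exact: Lfun2B (LW a) (grad_Lfun2 P_product a Lphi).
  have LF := cF.1.1.
  suff r0 (r : R) : r = \sum_(a <- B) dot (grad F a) (W a - grad phi a) -> `|r| <= 0.
    by apply/eqP; rewrite -normr_le0; exact: r0.
  move=> rE.
  pose D a := dot (grad F a) (grad F a).
  apply: (@le0_geometric _ _ (pairing F (grad F) + 1 + \sum_(a <- B) (4 * D a + 1)) _ z2).
  move=> n.
  (* The first term is the Euler-Lagrange defect of [u n], controlled by [u_weak]; the second is the
     error from replacing [phi] by [u n], controlled by [grad_cvg] and Cauchy-Schwarz. *)
  have -> : r = - (pairing (u n) (grad F) - pairing F W) +
      \sum_(a <- B) dot (grad (u n - phi) a) (grad F a).
    rewrite rE energyC !(pairingE _ FB) -sumrB -sumrN -big_split /=.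
    apply: eq_bigr => a _; have LFa := grad_Lfun2 P_product a LF.
    rewrite dot_gradBl// !(dotC P (grad F a)).
    rewrite (dotBl (LW a) (grad_Lfun2 P_product a Lphi) LFa).
    by rewrite opprB addrA subrK.
  rewrite mulrDl; apply: le_trans (ler_normD _ _) _; apply: lerD.
    rewrite normrN; apply: sqr_le_geometric; first exact: energy_ge0.
    by rewrite mulrC; exact: u_weak.
  apply: le_trans (ler_norm_sum _ _ _) _; rewrite mulr_suml; apply: ler_sum => a _.
  have LFa := grad_Lfun2 P_product a LF.
  apply: sqr_le_geometric; first by rewrite mulr_ge0// dot_ge0.
  apply: le_trans (cauchy_schwarz (grad_Lfun2 P_product a (LB n)) LFa) _.
  by rewrite mulrAC ler_wpM2r ?dot_ge0.
Qed.

End existence.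

(** * Unordered sums *)

Section unordered_sums.
Context (R : realType) (A : countType).
Implicit Types u v w : A -> R.

Lemma esum_EFin_le u (K : R) :
  (forall B : {fset A}, \sum_(a <- B) u a <= K) ->
  (\esum_(a in [set: A]) (u a)%:E <= K%:E)%E.
Proof.
move=> uK; apply: ge_ereal_sup => _ [X [finX _] <-].
by rewrite fsbig_finite//= sumEFin lee_fin.
Qed.

Lemma sum_le_esum (f : A -> \bar R) (B : {fset A}) :
  (\sum_(a <- B) f a <= \esum_(a in [set: A]) f a)%E.
Proof.
apply: esum_ge; exists [set` B]; first by split=> //; exact: finite_fset.
by rewrite -fsbig_seq.
Qed.

Lemma term_le_esum (f : A -> \bar R) a : (f a <= \esum_(a in [set: A]) f a)%E.
Proof. by have := sum_le_esum f [fset a]%fset; rewrite big_seq_fset1. Qed.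

Lemma esum_finsupp u (B : {fset A}) : (forall a, 0 <= u a) ->
  (forall a, a \notin B -> u a = 0) ->
  (\esum_(a in [set: A]) (u a)%:E = (\sum_(a <- B) u a)%:E)%E.
Proof.
move=> u0 uB; rewrite -sumEFin (fsbig_seq _ _ (fset_uniq B)) -esum_fset.
- rewrite [RHS]esum_mkcond; apply: eq_esum => a _; case: ifPn => //.
  by rewrite notin_setE /= => /negP /uB ->.
- exact: finite_fset.
- by move=> a _; rewrite lee_fin.
Qed.

(* The finite part [v] contributes its sum, the rest at most [eta]. *)
Lemma sumA_split u v w (B : {fset A}) (eta : R) : u = v + w ->
  (forall a, a \notin B -> v a = 0) ->
  (forall B' : {fset A}, \sum_(a <- B') `|w a| <= eta) ->
  `|sumA u - \sum_(a <- B) v a| <= eta.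
Proof.
move=> uvw vB weta.
pose p (f : A -> R) a := Num.max (f a) 0; pose m (f : A -> R) a := Num.max (- f a) 0.
have p0 f a : 0 <= p f a by rewrite /p le_max lexx orbT.
have m0 f a : 0 <= m f a by rewrite /m le_max lexx orbT.
have pmB f a : p f a - m f a = f a.
  by rewrite /p /m; have [?|?] := ltP (f a) 0; have [?|?] := ltP (- f a) 0; lra.
have pmD f a : p f a + m f a = `|f a|.
  rewrite /p /m; have [f0|f0] := ltP (f a) 0.
    by rewrite ltr0_norm// max_l ?add0r// oppr_ge0 ltW.
  by rewrite ger0_norm// max_r ?addr0// oppr_le0.
pose S (f : A -> R) := (\esum_(a in [set: A]) (f a)%:E)%E.
have SD f g : (forall a, 0 <= f a) -> (forall a, 0 <= g a) ->
    (S (fun a => f a + g a)%R = S f + S g)%E.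
  by move=> f0 g0; rewrite /S -esumD// => a _; rewrite lee_fin.
have Sle f g : (forall a, f a <= g a) -> (S f <= S g)%E.
  by move=> fg; apply: le_esum => a _; rewrite lee_fin.
have S0 f : (forall a, 0 <= f a) -> (0 <= S f)%E.
  by move=> f0; apply: esum_ge0 => a _; rewrite lee_fin.
have SwE : (S (p w) + S (m w) <= eta%:E)%E.
  rewrite -SD//; under eq_fun do rewrite pmD; exact: esum_EFin_le.
have fin (x y : \bar R) r : (0 <= x -> 0 <= y -> x + y <= r%:E -> x \is a fin_num)%E.
  move=> x0 y0 xyr; rewrite ge0_fin_numE//; apply: le_lt_trans (ltry r).
  by apply: le_trans xyr; rewrite leeDl.
have fpw := fin _ _ _ (S0 _ (p0 w)) (S0 _ (m0 w)) SwE.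
have fmw : S (m w) \is a fin_num.
  by apply: (fin _ (S (p w)) eta); rewrite ?S0// addeC.
have vpE : S (p v) = (\sum_(a <- B) p v a)%:E.
  by apply: esum_finsupp => // a /vB va; rewrite /p va maxxx.
have vmE : S (m v) = (\sum_(a <- B) m v a)%:E.
  by apply: esum_finsupp => // a /vB va; rewrite /m va oppr0 maxxx.
(* A subtraction-free form of [u = v + w]: all terms are nonnegative, so unordered sums may be taken
   on both sides. *)
have upm a : p u a + (m v a + m w a) = m u a + (p v a + p w a).
  have := pmB u a; have := pmB v a; have := pmB w a.
  by rewrite uvw !fctE; lra.
have upE a : p u a <= p v a + p w a.
  by rewrite {1}/p uvw ge_max addr_ge0// lerD// le_max lexx.
have umE a : m u a <= m v a + m w a by have := upm a; have := upE a; lra.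
have fpu : S (p u) \is a fin_num.
  rewrite ge0_fin_numE ?S0//; apply: le_lt_trans (Sle _ _ upE) _.
  by rewrite SD// vpE -(fineK fpw) -EFinD ltry.
have fmu : S (m u) \is a fin_num.
  rewrite ge0_fin_numE ?S0//; apply: le_lt_trans (Sle _ _ umE) _.
  by rewrite SD// vmE -(fineK fmw) -EFinD ltry.
have : (S (p u) + (S (m v) + S (m w)) = S (m u) + (S (p v) + S (p w)))%E.
  by rewrite -!SD//; [congr S; apply/funext|move=> a; rewrite addr_ge0..].
have -> : sumA u = fine (S (p u)) - fine (S (m u)) by [].
have -> : \sum_(a <- B) v a = \sum_(a <- B) p v a - \sum_(a <- B) m v a.
  by rewrite -sumrB; apply: eq_bigr => a _; rewrite pmB.
move: SwE; have := S0 _ (p0 w); have := S0 _ (m0 w); rewrite vpE vmE.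
rewrite -(fineK fpu) -(fineK fmu) -(fineK fpw) -(fineK fmw) -!EFinD !lee_fin /=.
move=> h1 h2 h3 [h4]; rewrite ler_norml; apply/andP; split; lra.
Qed.

Lemma sumA_finsupp u (B : {fset A}) : (forall a, a \notin B -> u a = 0) ->
  sumA u = \sum_(a <- B) u a.
Proof.
move=> uB; apply/eqP; rewrite -subr_eq0 -normr_le0.
apply: (@sumA_split u u 0 B 0 _ uB); first by rewrite addr0.
by move=> B'; rewrite big1// => a _; rewrite normr0.
Qed.

End unordered_sums.

(** * Existence of the decomposition *)

Section decomposition.
Context (R : realType) (A : countType) (E : A -> ptopologicalType).
Context (Pa : forall a, probability (borel (E a)) R).
Context (P : probability (prod_space E) R).
Hypothesis P_product : is_product_measure Pa P.
Implicit Types (F G H : prod_space E -> R) (U V W : A -> prod_space E -> R).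
Local Notation dot := (inner P).
Local Notation grad := (grad Pa).

Lemma sqnormE F : L2 P F -> sqnorm P F = (dot F F)%:E.
Proof. exact: integral_sqr. Qed.

Lemma L2_procP W : L2_proc P W <-> (forall a, L2 P (W a)) /\
  exists M : R, forall B : {fset A}, \sum_(a <- B) dot (W a) (W a) <= M.
Proof.
split=> [[mW Woo]|[LW [M WM]]].
  have LW a : L2 P (W a).
    by apply/Lfun2P; split=> //; apply: le_lt_trans Woo; exact: term_le_esum.
  split=> //; exists (fine (sqnorm_proc P W)) => B; rewrite -lee_fin fineK.
    rewrite -sumEFin; apply: le_trans (sum_le_esum _ B).
    by apply: lee_sum => a _; rewrite sqnormE//.
  rewrite ge0_fin_numE//; apply: esum_ge0 => a _; apply: integral_ge0 => x _.
  by rewrite lee_fin sqr_ge0.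
split=> [a|]; first exact: (Lfun2_measurable (LW a)).
apply: le_lt_trans (ltry M); rewrite /sqnorm_proc.
rewrite (eq_esum (b := fun a => (dot (W a) (W a))%:E)); first exact: esum_EFin_le.
by move=> a _; rewrite sqnormE//.
Qed.

(** Expand the square of [F + s *: G] for [s] equal to [k^-1] and [- k^-1], and multiply by [k].
    Such a bound sums directly over coordinates, and [k] can be tuned to the approximation error. *)
Lemma dot_le_weighted F G (k : R) : 0 < k -> L2 P F -> L2 P G ->
  `|dot F G| <= k * dot F F + k^-1 * dot G G.
Proof.
move=> k0 LF LG.
have e (s : R) : 0 <= dot F F + 2 * s * dot F G + s ^+ 2 * dot G G.
  rewrite -(form_addZ (@Lfun2D _ _ _ P) (@Lfun2Z _ _ _ P) (dotC P)
    (@dotDl _ _ _ P) (@dotZl _ _ _ P))//; exact: dot_ge0.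
have F0 := dot_ge0 P F; have G0 := dot_ge0 P G.
have ki0 : 0 < k^-1 by rewrite invr_gt0.
have kk : k * k^-1 = 1 by rewrite mulfV// gt_eqF.
have kF : 0 <= k * dot F F by rewrite mulr_ge0// ltW.
have kG : 0 <= k^-1 * dot G G by rewrite mulr_ge0// ltW.
have h s : s ^+ 2 = k^-1 ^+ 2 ->
    0 <= k * dot F F + 2 * (k * s) * dot F G + k^-1 * dot G G.
  move=> s2; have -> : k * dot F F + 2 * (k * s) * dot F G + k^-1 * dot G G
    = k * (dot F F + 2 * s * dot F G + s ^+ 2 * dot G G).
    by rewrite s2 !mulrDr; congr (_ + _ + _);
      [ring|rewrite expr2 !mulrA kk mul1r].
  by rewrite mulr_ge0// ltW.
have := h k^-1 erefl; have := h (- k^-1); rewrite sqrrN mulrN kk => /(_ erefl).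
by rewrite ler_norml => h1 h2; apply/andP; split; lra.
Qed.

(* Orthogonality to gradients of cylindrical functions extends to [domD]. *)
Lemma grad_pairing_domD W : L2_proc P W ->
  (forall F (B : {fset A}), L2 P F -> depends F B ->
     \sum_(a <- B) dot (grad F a) (W a) = 0) ->
  forall F, domD Pa P F -> grad_pairing Pa P F W = 0.
Proof.
move=> /L2_procP[LW [M WM]] Worth F [LF approx].
have z2 : `|2^-1| < 1 :> R by rewrite ger0_norm ?invr_ge0// invf_lt1 ?ltr1n.
(* Approximation error [4^-1 ^+ n] and weight [2 ^+ n] give [2 ^+ n * 4^-1 ^+ n + 2^-1 ^+ n * M],
   that is [(1 + M) * 2^-1 ^+ n]. *)
apply/eqP; rewrite -normr_le0; apply: (le0_geometric (C := 1 + M) z2) => n.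
have e0 : 0 < 4^-1 ^+ n :> R by rewrite exprn_gt0// invr_gt0.
have k0 : 0 < 2 ^+ n :> R by rewrite exprn_gt0.
have [G [LG [B GB]] FGe] := approx _ e0.
have LFG : L2 P (F - G) := Lfun2B LF LG.
have De (B' : {fset A}) :
    \sum_(a <- B') dot (grad (F - G) a) (grad (F - G) a) <= 4^-1 ^+ n.
  rewrite -lee_fin; apply: le_trans (ltW FGe).
  apply: (@le_trans _ _ (sqnorm_proc P (grad (F - G)))); last first.
    by rewrite leeDr//; apply: integral_ge0 => x _; rewrite lee_fin sqr_ge0.
  rewrite -sumEFin; apply: le_trans (sum_le_esum _ B').
  by apply: lee_sum => a _; rewrite sqnormE//; exact: grad_Lfun2.
(* The cylindrical part [G] contributes a finite sum that vanishes by orthogonality; [F - G] is the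
   small remainder. *)
have := @sumA_split R A (fun a => dot (grad F a) (W a))
  (fun a => dot (grad G a) (W a)) (fun a => dot (grad (F - G) a) (W a)) B
  ((1 + M) * 2^-1 ^+ n).
rewrite Worth// subr0; apply.
- by apply/funext => a; rewrite !fctE dot_gradBl// addrC subrK.
- by move=> a aB; rewrite (grad_depends Pa GB aB); exact: dot0l.
- move=> B'; apply: (@le_trans _ _ (\sum_(a <- B')
    (2 ^+ n * dot (grad (F - G) a) (grad (F - G) a) +
     (2 ^+ n)^-1 * dot (W a) (W a)))).
    by apply: ler_sum => a _; apply: dot_le_weighted => //; exact: grad_Lfun2.
  rewrite big_split /= -!mulr_sumr mulrDl mul1r exprVn; apply: lerD; last first.
    by rewrite [leRHS]mulrC; apply: ler_wpM2l (WM B'); rewrite invr_ge0 ltW.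
  have -> : (2 ^+ n)^-1 = 2 ^+ n * 4^-1 ^+ n :> R.
    by rewrite -exprMn -exprVn; congr (_ ^+ _); field.
  by apply: ler_wpM2l (De B'); exact: ltW.
Qed.

Lemma helmholtz_exists U : L2_proc P U -> exists phi V, helmholtz Pa P U phi V.
Proof.
move=> /L2_procP[LU [M UM]].
have [phi [Lphi phi0 [K phiK] phi_orth]] := gradient_projection P_product LU UM.
have Lg a : L2 P (grad phi a) by exact: grad_Lfun2.
pose V a := U a - grad phi a.
have LV : L2_proc P V.
  apply/L2_procP; split=> [a|]; first exact: Lfun2B (LU a) (Lg a).
  exists (2 * M + 2 * K) => B.
  apply: (@le_trans _ _ (\sum_(a <- B)
    (2 * dot (U a) (U a) + 2 * dot (grad phi a) (grad phi a)))).
    by apply: ler_sum => a _; exact: dotB_le2 (LU a) (Lg a).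
  by rewrite big_split /= -!mulr_sumr lerD// ler_pM2l.
have pair0 F : domD Pa P F -> grad_pairing Pa P F V = 0.
  exact: grad_pairing_domD.
exists phi, V; split=> //.
- by rewrite -(dot_cst1 P).
- split; last by move=> F /pair0 ->; rewrite -[LHS](Rintegral_prob_cst P);
    apply: eq_Rintegral => x _; rewrite mulr0.
    (* All pairings vanish, so any positive constant bounds them. *)
    split=> //; exists 1 => // F /pair0 ->.
    by rewrite normr0 mul1e Lnorm_ge0.
  exact: Lfun_cst.
- move=> a; apply: aeW => x.
  by rewrite [V a x](_ : _ = U a x - grad phi a x)// addrC subrK.
Qed.

End decomposition.

(** * Uniqueness *)

Section tensor_functions.
Context (R : realType) (A : countType) (E : A -> ptopologicalType).
Context (Pa : forall a, probability (borel (E a)) R).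
Context (P : probability (prod_space E) R).
Hypothesis P_product : is_product_measure Pa P.
Implicit Types (F G H psi phi : prod_space E -> R) (U V W : A -> prod_space E -> R).
Local Notation dot := (inner P).
Local Notation grad := (grad Pa).
Context (C : forall a, set (borel (E a))).
Arguments C : clear implicits.
Hypothesis mC : forall a, measurable (C a).

Let p a : R := fine (Pa a (C a)).
Let ind a (y : borel (E a)) : R := \1_(C a) y.

(** Two lists, so that indicators can be turned into centered factors one at a time, from the
    indicator of a rectangle [tensor B [::]] to the eigenvectors [tensor [::] s]. *)
Definition tensor (s1 s2 : seq A) (x : prod_space E) : R :=
  (\prod_(a <- s1) ind (x a)) * \prod_(a <- s2) (ind (x a) - p a).

Let p01 a : 0 <= p a <= 1.
Proof.
apply/andP; split; first exact: fine_ge0.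
rewrite /p -lee_fin fineK ?fin_num_measure//.
exact (probability_le1 (Pa a) (@mC a)).
Qed.

Let ind01 a (y : borel (E a)) : 0 <= ind y <= 1.
Proof. by rewrite /ind indicE; case: (_ \in _); rewrite ?lexx ler01. Qed.

Let measurable_ind a : measurable_fun setT (@ind a).
Proof. by apply/measurable_indic; exact: mC. Qed.

Let measurable_ind_coord a :
  measurable_fun setT (fun x : prod_space E => ind (x a)).
Proof.
exact: (@measurableT_comp _ _ _ _ _ _ (@ind a) setT
  (fun x : prod_space E => x a : borel (E a)) (@measurable_ind a)
  (@measurable_coord A E a)).
Qed.

Lemma prod_norm_le1 (s : seq A) (f : A -> R) :
  (forall a, `|f a| <= 1) -> `|\prod_(a <- s) f a| <= 1.
Proof.
move=> f1; elim: s => [|a s IH]; first by rewrite big_nil normr1.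
by rewrite big_cons normrM mulr_ile1.
Qed.

Lemma tensor_Lfun2 s1 s2 : L2 P (tensor s1 s2).
Proof.
apply: (@Lfun2_bounded _ _ _ _ _ 1).
  apply: measurable_funM; apply: measurable_prod => a _.
    exact: measurable_ind_coord.
  by apply: measurable_funB => //; exact: measurable_ind_coord.
move=> x; rewrite /tensor normrM mulr_ile1//; apply: prod_norm_le1 => a.
  by have /andP[h0 h1] := ind01 (x a); rewrite ger0_norm.
have /andP[h0 h1] := ind01 (x a); have /andP[p0 p1] := p01 a.
by rewrite ler_norml; apply/andP; split; lra.
Qed.

Lemma tensor_depends s : depends (tensor [::] s) [fset a in s]%fset.
Proof.
move=> x y xy; rewrite /tensor !big_nil; congr (_ * _).
by apply: eq_big_seq => a aS; rewrite xy// inE.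
Qed.

(** By [uniq s], exactly one factor involves coordinate [a], and that factor has mean zero. *)
Lemma cexp_tensor s a : uniq s -> a \in s -> cexp Pa (tensor [::] s) a = 0.
Proof.
move=> us aS; apply/funext => x; rewrite /cexp /tensor.
pose K := \prod_(b <- rem a s) (ind (x b) - p b).
transitivity (\int[Pa a]_(y in [set: borel (E a)]) ((ind y - p a) * K)).
  apply: eq_Rintegral => y _.
  rewrite big_nil mul1r (big_rem a)//= dfwithin; congr (_ * _).
  apply: eq_big_seq => b; rewrite mem_rem_uniq// inE => /andP[ba _].
  by rewrite dfwithout// eq_sym.
have LI : @ind a \in Lfun (Pa a) 2%:E.
  apply: (@Lfun2_bounded _ _ _ _ _ 1) => // y.
  by have /andP[h0 h1] := ind01 y; rewrite ger0_norm.
have Lp : (cst (p a) : borel (E a) -> R) \in Lfun (Pa a) 2%:E by exact: Lfun_cst.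
rewrite RintegralZr//; last exact: (Lfun2_integrable (Lfun2B LI Lp)).
rewrite RintegralB//; [|exact: Lfun2_integrable LI|exact: Lfun2_integrable Lp].
rewrite Rintegral_prob_cst.
have -> : \int[Pa a]_y ind y = p a.
  by rewrite /Rintegral integral_indic// setIT.
by rewrite subrr mul0r.
Qed.

Lemma grad_tensor s a : uniq s -> a \in s -> grad (tensor [::] s) a = tensor [::] s.
Proof. by move=> us aS; rewrite gradE cexp_tensor// subr0. Qed.

Lemma cylindrical_domD F : cylindrical P F -> domD Pa P F.
Proof.
move=> cF; split=> [|e e0]; first by case: cF.
exists F => //.
have -> : (F \- F)%R = cst 0 by apply/funext => x /=; rewrite subrr.
have s0 : sqnorm P (cst 0) = 0%E.
  by rewrite /sqnorm; under eq_integral do rewrite expr0n; rewrite integral0.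
rewrite s0 add0e /sqnorm_proc esum1 ?lte_fin// => a _.
by rewrite (grad_depends Pa (B := fset0)).
Qed.

Lemma divergence0_cylindrical V F (B : {fset A}) :
  is_divergence Pa P V (cst 0) -> L2 P F -> depends F B ->
  \sum_(a <- B) dot (grad F a) (V a) = 0.
Proof.
move=> [_ _ Vpair] LF FB; rewrite -(sumA_finsupp (B := B)); last first.
  by move=> a aB; rewrite (grad_depends Pa FB aB); exact: dot0l.
have /Vpair : domD Pa P F by apply: cylindrical_domD; split=> //; exists B.
move=> h; apply: (etrans h); rewrite -[RHS](Rintegral_prob_cst P).
by apply: eq_Rintegral => x _; rewrite mulr0.
Qed.

(* [tensor [::] s] is an eigenvector of [delta D] for the eigenvalue [size s]. *)
Lemma helmholtz_tensor U phi V s : (forall a, L2 P (U a)) ->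
  helmholtz Pa P U phi V -> uniq s ->
  #|` [fset a in s]%fset|%:R * dot (tensor [::] s) phi =
  \sum_(a <- [fset a in s]%fset) dot (tensor [::] s) (U a).
Proof.
move=> LU [Lphi /L2_procP[LV _] _ dV UE] us; set B := [fset a in s]%fset.
have LT := tensor_Lfun2 [::] s.
have := divergence0_cylindrical dV LT (@tensor_depends s); rewrite -/B => V0.
rewrite [RHS](eq_big_seq (fun a => dot (tensor [::] s) phi +
    dot (grad (tensor [::] s) a) (V a))).
  rewrite big_split /= V0 addr0 big_const_seq count_predT iter_addr_0.
  by rewrite mulr_natl.
move=> a; rewrite inE => as_; rewrite grad_tensor//.
have Lg := grad_Lfun2 P_product a Lphi; have Lc := cexp_Lfun2 P_product a Lphi.
(* Self-adjointness moves the gradient from [phi] to the tensor, which it fixes. *)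
have gT : dot (tensor [::] s) (grad phi a) = dot (tensor [::] s) phi.
  rewrite dotC gradE (dotBl Lphi Lc LT) (dotC P (cexp Pa phi a)).
  by rewrite (dot_cexp P_product a Lphi LT) cexp_tensor// dot0l subr0 dotC.
rewrite dotC (eq_dotl (G := grad phi a + V a) (LU a) (Lfun2D Lg (LV a)) LT (UE a)).
by rewrite (dotDl Lg (LV a) LT) (dotC P (grad phi a)) gT (dotC P (V a)).
Qed.

(* Expand each indicator as its mean plus its centered part. *)
Lemma tensor_orth psi : L2 P psi ->
  (forall s, uniq s -> dot (tensor [::] s) psi = 0) ->
  forall s1 s2, uniq (s1 ++ s2) -> dot (tensor s1 s2) psi = 0.
Proof.
move=> Lpsi psi0; elim=> [|a s1 IH] s2; first exact: psi0.
have -> : tensor (a :: s1) s2 = tensor s1 (a :: s2) + p a *: tensor s1 s2.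
  apply/funext => x.
  rewrite [RHS](_ : _ = tensor s1 (a :: s2) x + p a * tensor s1 s2 x)//.
  by rewrite /tensor !big_cons; ring.
move=> us; have us1 : uniq (s1 ++ a :: s2) by rewrite -cat_rcons -cats1 -catA uniq_catCA.
have us2 : uniq (s1 ++ s2) by case/andP: us.
have L12 := tensor_Lfun2 s1 s2; have L12' := tensor_Lfun2 s1 (a :: s2).
by rewrite (dotDl L12' (Lfun2Z _ L12) Lpsi) (dotZl _ L12 Lpsi) !IH// mulr0 addr0.
Qed.

Lemma tensor_rect (B : {fset A}) x : tensor B [::] x = \1_(rect B C) x.
Proof.
rewrite /tensor big_nil mulr1 indicE.
have [Bx|nBx] := boolP (x \in rect B C).
  rewrite big1_seq// => a /= aB; rewrite /ind indicE mem_set//.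
  by move: Bx; rewrite inE; apply.
have [a aB nCa] : exists2 a, a \in B & ~ C a (x a).
  apply: contrapT => h; move/negP: nBx; apply; rewrite inE => a aB.
  by apply: contrapT => nC; apply: h; exists a.
by rewrite (big_rem a)//= /ind indicE memNset// mul0r.
Qed.

Lemma integral_rect psi (B : {fset A}) : L2 P psi ->
  (\int[P]_(x in rect B C) (psi x)%:E = (dot (tensor B [::]) psi)%:E)%E.
Proof.
move=> Lpsi; have iTp := Lfun2M (tensor_Lfun2 B [::]) Lpsi.
rewrite /inner /Rintegral fineK; last exact: integrable_fin_num iTp.
rewrite [LHS]integral_mkcond; apply: eq_integral => x _.
rewrite tensor_rect patchE indicE; case: (x \in rect B C); first by rewrite mul1r.
by rewrite mul0r.
Qed.

End tensor_functions.

(** * From integrals over rectangles to almost sure uniqueness *)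

Section uniqueness.
Context (R : realType) (A : countType) (E : A -> ptopologicalType).
Context (P : probability (prod_space E) R).

(** Measurable sets over which [psi] integrates to 0 form a Dynkin system containing the pi-system
    of rectangles, hence include every measurable set. *)
Lemma ae0_of_rects (psi : prod_space E -> R) : L2 P psi ->
  (forall D, rects D -> (\int[P]_(x in D) (psi x)%:E = 0)%E) ->
  {ae P, forall x, psi x = 0}.
Proof.
move=> Lpsi h.
have ipsi := Lfun2_integrable Lpsi.
pose G := [set D : set (prod_space E) |
  measurable D /\ (\int[P]_(x in D) (psi x)%:E = 0)%E].
have dG : dynkin G.
  split.
  - by split=> //; apply: h; exact: setT_rects.
  - move=> D [mD D0]; split; first exact: measurableC.
    have := h _ (@setT_rects A E); rewrite -(setUv D) integral_setU_EFin//.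
    + by rewrite D0 add0e.
    + exact: measurableC.
    + by rewrite setUv; exact: Lfun2_measurable Lpsi.
    + by apply/disj_setPS; rewrite setICr.
  - move=> F tF GF; split; first by apply: bigcupT_measurable => n; exact: (GF n).1.
    rewrite integral_bigcup//; last 2 first.
    + by move=> n; exact: (GF n).1.
    + by apply: integrableS ipsi => //; apply: bigcupT_measurable => n; exact: (GF n).1.
    by apply: eseries0 => n _ _; exact: (GF n).2.
have GT D : measurable D -> G D.
  rewrite (measurable_rects E) -(setI_closed_g_dynkin_g_sigma_algebra (@rects_setI A E)).
  apply: smallest_sub => // D' rD'; split; last exact: h.
  by case: rD' => B [C [mC ->]]; exact: measurable_rect.
have : ae_eq P setT (EFin \o psi) (cst 0%E).
  apply: integral_ae_eq => // D _ mD.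
  by rewrite integral_cst// mul0e; exact: (GT D mD).2.
by move=> e; apply: (ae_imply e) => x /(_ I) [].
Qed.


Context (Pa : forall a, probability (borel (E a)) R).
Hypothesis P_product : is_product_measure Pa P.
Local Notation grad := (grad Pa).

Lemma helmholtz_potential_unique U phi V phi' V' : (forall a, L2 P (U a)) ->
  helmholtz Pa P U phi V -> helmholtz Pa P U phi' V' ->
  {ae P, forall x, (phi' - phi) x = 0}.
Proof.
move=> LU hphi hphi'; have [Lphi _ mphi _ _] := hphi; have [Lphi' _ mphi' _ _] := hphi'.
have Lpsi : L2 P (phi' - phi) := Lfun2B Lphi' Lphi.
apply: ae0_of_rects => // _ [B [C [mC ->]]].
rewrite (integral_rect Pa mC)//; congr (_%:E).
apply: (tensor_orth mC) => //; last by rewrite cats0 fset_uniq.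
move=> s us; have LT := tensor_Lfun2 Pa P mC [::] s.
rewrite dotC (dotBl Lphi' Lphi LT) !(dotC P _ (tensor _ _ _ _)).
(* For empty [s] the eigenvalue is 0 and [helmholtz_tensor] says nothing; the normalization to mean
   zero settles this case. *)
have [->|s0] := eqVneq s [::].
  have -> : tensor Pa C [::] [::] = cst 1.
    by apply/funext => x; rewrite /tensor !big_nil mulr1.
  by rewrite !(dotC P (cst 1)) !dot_cst1 mphi mphi' subrr.
have B0 : (#|` [fset a in s]%fset|%:R : R) != 0.
  rewrite pnatr_eq0 cardfs_eq0; case: s s0 {us LT} => // a s _.
  by apply/fset0Pn; exists a; rewrite !inE eqxx.
apply/eqP; rewrite subr_eq0; apply/eqP/(mulfI B0).
by rewrite (helmholtz_tensor P_product mC LU hphi us)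
  (helmholtz_tensor P_product mC LU hphi' us).
Qed.

Lemma helmholtz_unique U phi V phi' V' : (forall a, L2 P (U a)) ->
  helmholtz Pa P U phi V -> helmholtz Pa P U phi' V' ->
  {ae P, forall x, phi' x = phi x} /\
  (forall a : A, {ae P, forall x, V' a x = V a x}).
Proof.
move=> LU h h'; have psi0 := helmholtz_potential_unique LU h h'.
move: h h' => [Lphi _ _ _ UE] [Lphi' _ _ _ UE'].
split; first by apply: (ae_imply psi0) => x /subr0_eq.
move=> a; have Lpsi : L2 P (phi' - phi) := Lfun2B Lphi' Lphi.
have L0 : L2 P (0 : prod_space E -> R) by exact: Lfun_cst.
(* Almost sure equality survives [grad], although single fibers may be affected, because [grad _ a]
   contracts the L^2 norm. *)
have g0 : {ae P, forall x, grad (phi' - phi) a x = 0}.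
  apply: dot_eq0; first exact: grad_Lfun2.
  apply/eqP; rewrite eq_le dot_ge0 andbT.
  apply: le_trans (dot_grad_le P_product a Lpsi) _.
  by rewrite (eq_dot Lpsi L0 psi0) dot0l.
have gB := grad_addZ P_product (-1) a Lphi' Lphi.
rewrite scaleN1r in gB.
have gE : {ae P, forall x, grad phi' a x = grad phi a x}.
  apply: (ae_imply2 g0 gB) => x ->.
  rewrite [X in 0 = X](_ : _ = grad phi' a x + -1 * grad phi a x)//; lra.
have VE : {ae P, forall x, grad phi a x + V a x = grad phi' a x + V' a x}.
  by apply: (ae_imply2 (UE a) (UE' a)) => x <-.
by apply: (ae_imply2 gE VE) => x -> /addrI.
Qed.

End uniqueness.

Theorem theorem3p10 (R : realType) (A : countType) (E : A -> ptopologicalType)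
    (E_polish : forall a : A, polish R (E a))
    (Pa : forall a : A, probability (borel (E a)) R)
    (P : probability (prod_space E) R)
    (P_product : is_product_measure Pa P)
    (U : A -> prod_space E -> R) (U_Dl2 : Dl2 Pa P U) :
  exists (phi : prod_space E -> R) (V : A -> prod_space E -> R),
    helmholtz Pa P U phi V /\
    forall (phi' : prod_space E -> R) (V' : A -> prod_space E -> R),
      helmholtz Pa P U phi' V' ->
      {ae P, forall x, phi' x = phi x} /\
      (forall a : A, {ae P, forall x, V' a x = V a x}).
Proof.
have [U2 _] := U_Dl2; have [phi [V hphi]] := helmholtz_exists P_product U2.
have [LU _] := (L2_procP P U).1 U2.
exists phi, V; split=> // phi' V' hphi'.
exact: (helmholtz_unique P_product LU hphi hphi').
Qed.
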